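(* Let $U_h\in L^1(\mathcal{F}_h)$ be a given approximation of the exact flux $U=\mathbf{u}\cdot\mathbf{n}$ on $\mathcal{F}_h$, and define the postprocessed flux $V_h$ by $$V_h=\begin{cases}U_h & \text{on } \mathcal{F}_{h,N},\\ U_h+\omega^{-1}[y] & \text{on } \mathcal{F}_h\setminus\mathcal{F}_{h,N},\end{cases}$$ where $y\in P_0(\mathcal{E}_h)$ is the unique solution of $$\langle\omega^{-1}[y],[w]\rangle_{\mathcal{F}_h\setminus\mathcal{F}_{h,N}}=(\mathcal{R}(U_h),w)_{\mathcal{E}_h}\qquad\forall w\in P_0(\mathcal{E}_h).$$ Then the postprocessed flux $V_h$ (i) is locally conservative, i.e. $\int_{\partial E}V_h\,\mathbf{n}_F\cdot\mathbf{n}_E=\int_E q$ for all $E\in\mathcal{E}_h$; (ii) is uniquely defined; and (iii) has the same convergence order as the original flux $U_h$, i.e. if $\|U-U_h\|_{h,\mathcal{F}_h}\lesssim h^s$, then $\|U-V_h\|_{h,\mathcal{F}_h}\lesssim h^s$.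
   Context: **Problem.** $\Omega\subset\mathbb{R}^d$ ($d=2,3$) is a bounded domain whose boundary is divided into a Dirichlet part $\Gamma_D$ and a Neumann part $\Gamma_N$, with $\Gamma_D\cap\Gamma_N=\emptyset$ and $\overline{\Gamma}_D\cup\overline{\Gamma}_N=\partial\Omega$. The pressure $p$ solves the stationary flow equation $-\nabla\cdot(\mathbf{K}\nabla p)=q$ in $\Omega$, with $p=p_B$ on $\Gamma_D$ and $\mathbf{u}\cdot\mathbf{n}=u_B$ on $\Gamma_N$, where $\mathbf{u}=-\mathbf{K}\nabla p$ is the velocity, $\mathbf{n}$ is the outward unit normal on $\partial\Omega$, $q$ is a source term, $p_B,u_B$ are known functions, and $\mathbf{K}=\mathbf{K}(\mathbf{x})$ is symmetric positive definite and bounded from below and above. **Mesh.** $\mathcal{E}_h$ is a partition of $\Omega$ into convex elements (triangles or quadrilaterals if $d=2$; tetrahedra, prisms or hexahedra if $d=3$; mixed types and hanging nodes are allowed). Let $h_E$ be the diameter of $E\in\mathcal{E}_h$ and $h$ the maximum diameter. There is $\rho>0$ such that each $E$ contains a ball of radius $\rho h_E$ in its interior, and there is $\tau>0$ such that $h/h_E\le\tau$ for all $E\in\mathcal{E}_h$ (quasi-uniformity). The interior faces $\mathcal{F}_{h,I}$ are the $(d-1)$-dimensional sets $F=E_i\cap E_j$ with $E_i\ne E_j$ in $\mathcal{E}_h$. The boundary faces are the element faces on $\partial\Omega$; each is assumed to lie completely on the Dirichlet or completely on the Neumann part of the boundary, which gives the sets $\mathcal{F}_{h,D}$ and $\mathcal{F}_{h,N}$.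 Put $\mathcal{F}_h=\mathcal{F}_{h,I}\cup\mathcal{F}_{h,D}\cup\mathcal{F}_{h,N}$. Each face $F$ has a chosen unit normal $\mathbf{n}_F$ (outward to $\Omega$ on boundary faces), and $\mathbf{n}_E$ is the unit normal pointing out of $E$. The exact flux on $F$ is $U=\mathbf{u}\cdot\mathbf{n}_F$. **Spaces and jumps.** $L^1(\mathcal{F}_h)$ is the space of integrable functions on the faces. $P_0(\mathcal{E}_h)$ is the space of functions that are constant on each element. For $w\in P_0(\mathcal{E}_h)$ the jump is $[w]|_F=w|_{E_i}-w|_{E_j}$ on an interior face $F=\partial E_i\cap\partial E_j$ with $\mathbf{n}_F$ exterior to $E_i$, and $[w]|_F=w|_{E_i}$ on a boundary face $F\subset\partial E_i$. **Weight.** $\omega$ is a given bounded weight with $\omega|_F=\omega_F>0$ for each $F\in\mathcal{F}_h$. **Inner products and norm.** $\langle v,w\rangle_{\mathcal{G}}=\sum_{F\in\mathcal{G}}\int_F vw$ for a set $\mathcal{G}$ of faces; $(v,w)_{\mathcal{E}_h}=\sum_{E\in\mathcal{E}_h}\int_E vw$; $\|v\|_{h,\mathcal{F}_h}^2=\sum_{F\in\mathcal{F}_h}h\,\|v\|_{L^2(F)}^2$. **Residual.** The discrete divergence $D_h:L^1(\mathcal{F}_h)\to P_0(\mathcal{E}_h)$ is defined by $\int_E D_hv=\int_{\partial E}v\,\mathbf{n}_F\cdot\mathbf{n}_E$ for all $E\in\mathcal{E}_h$, where on $\partial E$ the symbol $F$ denotes the face containing the point. With $P_0q$ the $L^2$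 projection of $q$ onto $P_0(\mathcal{E}_h)$, i.e. $(P_0q)|_E=|E|^{-1}\int_Eq$, the residual is $\mathcal{R}(U_h)=P_0q-D_hU_h$. **Convention.** $x\lesssim y$ means that there is a constant $C>0$ independent of $h$ such that $x\le Cy$.
   Formalization: Part (iii) additionally assumes U_h = U a.e. on Neumann faces (it fails otherwise); the weight ω is assumed bounded below by a positive constant uniformly in h; each mesh has at least one Dirichlet face, needed for y to be unique. *)

(* Defs.v *)
From HB Require Import structures.
From mathcomp Require Import all_boot all_order all_algebra.
From mathcomp Require Import all_classical all_reals all_analysis.
From mathcomp Require Import measurable_realfun.
Import numFieldNormedType.Exports.
Set Implicit Arguments. Unset Strict Implicit. Unset Printing Implicit Defensive.
Import Order.TTheory GRing.Theory Num.Theory.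
Local Open Scope classical_set_scope.
Local Open Scope ring_scope.

Definition rV_display : measure_display. Proof. exact: default_measure_display. Qed.

Section rV_measurable.
Context (R : realType) (n : nat).

(* Generated by the coordinates, as the library does for tuples; since the
   topology of R^n is second countable this is the Borel sigma-algebra. *)
Definition rV_measurable : set (set 'rV[R]_n) :=
  g_sigma_preimage (fun (i : 'I_n) (x : 'rV[R]_n) => (x 0 i : measurableTypeR R)).

Let m0 : rV_measurable set0. Proof. exact: sigma_algebra0. Qed.
Let mC A : rV_measurable A -> rV_measurable (~` A).
Proof. exact: sigma_algebraC. Qed.
Let mU (F : (set _)^nat) : (forall i, rV_measurable (F i)) -> rV_measurable (\bigcup_i F i).
Proof. exact: sigma_algebra_bigcup. Qed.

HB.instance Definition _ := @isMeasurable.Build rV_display 'rV[R]_n rV_measurable m0 mC mU.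

Lemma measurable_coord (i : 'I_n) :
  measurable_fun setT (fun x : 'rV[R]_n => (x 0 i : measurableTypeR R)).
Proof.
move=> _ Y mY; rewrite setTI; apply: sub_sigma_algebra => /=.
rewrite -bigcup_seq/=; exists i => /=; first by rewrite mem_index_enum.
by exists Y => //; rewrite setTI.
Qed.

Lemma measurable_fun_rVP d (T : measurableType d) (f : T -> 'rV[R]_n) :
  (forall i, measurable_fun setT (fun t => (f t 0 i : measurableTypeR R))) ->
  measurable_fun setT f.
Proof.
move=> mf _ A; rewrite setTI.
have : (<<s \big[setU/set0]_(i < n) preimage_set_system setT
   (fun x : 'rV[R]_n => (x 0 i : measurableTypeR R)) measurable >>) `<=`
   [set A | measurable (f @^-1` A)].
  apply: smallest_sub.
    split => /=; first by rewrite preimage_set0.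
    - by move=> B mB; rewrite setTD preimage_setC; apply: measurableC.
    - by move=> F mF; rewrite preimage_bigcup; exact: bigcup_measurable.
  rewrite -bigcup_seq; apply: bigcup_sub => i _ _ [B mB <-] /=.
  rewrite -[X in measurable X]setTI preimage_setI preimage_setT setTI.
  by have := mf i measurableT _ mB; rewrite setTI.
exact.
Qed.
End rV_measurable.

Section lebesgue.
Context (R : realType).

Definition rV_cons (n : nat) (z : measurableTypeR R * 'rV[R]_n) : 'rV[R]_n.+1 :=
  row_mx (z.1 : R)%:M z.2 : 'rV[R]_(1 + n).

Lemma rV_cons0 n z : @rV_cons n z 0 0 = z.1.
Proof.
have -> : 0 = lshift n 0 :> 'I_(1 + n) by apply/val_inj.
by apply: etrans (row_mxEl _ _ _ _) _; rewrite mxE eqxx mulr1n.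
Qed.

Lemma rV_consS n z (j : 'I_n) : @rV_cons n z 0 (lift 0 j) = z.2 0 j.
Proof.
have -> : lift 0 j = rshift 1 j :> 'I_(1 + n) by apply/val_inj.
exact: row_mxEr.
Qed.

Lemma measurable_rV_cons n : measurable_fun setT (@rV_cons n).
Proof.
apply: measurable_fun_rVP => i; case: (unliftP 0 i) => [j|] ->.
- under eq_fun do rewrite rV_consS.
  exact: measurableT_comp (measurable_coord j) (@measurable_snd _ _ _ _).
- under eq_fun do rewrite rV_cons0.
  exact: measurable_fst.
Qed.

Section succ.
Context (n : nat) (mu : {sigma_finite_measure set 'rV[R]_n -> \bar R}).

Definition lebesgue_cons : set 'rV[R]_n.+1 -> \bar R :=
  pushforward (@lebesgue_measure R \x mu)%E (@rV_cons n).

Let mc := @measurable_rV_cons n.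
Let m0 : lebesgue_cons set0 = 0%E.
Proof. by rewrite /lebesgue_cons /pushforward preimage_set0 measure0. Qed.
Let mp A : (0 <= lebesgue_cons A)%E. Proof. exact: measure_ge0. Qed.
Let ma : semi_sigma_additive lebesgue_cons.
Proof.
move=> F mF tF mUF; rewrite /lebesgue_cons/pushforward preimage_bigcup.
apply: measure_semi_sigma_additive.
- by move=> k; rewrite -[X in measurable X]setTI; exact: mc.
- apply/trivIsetP => /= i j _ _ ij; rewrite -preimage_setI.
  by move/trivIsetP : tF => /(_ _ _ _ _ ij) ->//; rewrite preimage_set0.
- by rewrite -preimage_bigcup -[X in measurable X]setTI; exact: mc.
Qed.
HB.instance Definition _ := isMeasure.Build _ _ _ lebesgue_cons m0 mp ma.

Let sf : sigma_finite setT lebesgue_cons.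
Proof.
have /sigma_finiteP[F [TF ndF Foo]] := sigma_finiteT (@lebesgue_measure R).
have /sigma_finiteP[G [TG ndG Goo]] := sigma_finiteT mu.
pose tl (x : 'rV[R]_n.+1) : 'rV[R]_n := \row_j x 0 (lift 0 j).
have mtl : measurable_fun setT tl.
  by apply: measurable_fun_rVP => i; under eq_fun do rewrite mxE; exact: measurable_coord.
pose hd (x : 'rV[R]_n.+1) : measurableTypeR R := x 0 0.
have mhd : measurable_fun setT hd by exact: measurable_coord.
have hdE z : hd (rV_cons z) = z.1 by exact: rV_cons0.
have tlE z : tl (rV_cons z) = z.2.
  by apply/rowP => j; rewrite mxE rV_consS.
exists (fun k => hd @^-1` F k `&` tl @^-1` G k).
  apply/esym; rewrite -subTset => x _.
  have [i _ Fi] : (\bigcup_i F i) (hd x) by rewrite -TF.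
  have [j _ Gj] : (\bigcup_i G i) (tl x) by rewrite -TG.
  exists (maxn i j) => //; split => /=.
  - by move: Fi; exact/subsetPset/ndF/leq_maxl.
  - by move: Gj; exact/subsetPset/ndG/leq_maxr.
move=> k; have [mF Fk] := Foo k; have [mG Gk] := Goo k; split.
  apply: measurableI; rewrite -[X in measurable X]setTI; [exact: mhd|exact: mtl].
rewrite /lebesgue_cons /pushforward.
rewrite (_ : _ @^-1` _ = F k `*` G k); last first.
  by apply/seteqP; split => z /=; rewrite hdE tlE.
by rewrite product_measure1E// lte_mul_pinfty// ge0_fin_numE.
Qed.
HB.instance Definition _ := Measure_isSigmaFinite.Build _ _ _ lebesgue_cons sf.
End succ.

(* n-dimensional Lebesgue measure, as an iterated product of the
   one-dimensional one *)
Fixpoint lebesgue_rV (n : nat) : {sigma_finite_measure set 'rV[R]_n -> \bar R} :=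
  match n with
  | 0 => \d_(0 : 'rV[R]_0)
  | n'.+1 => lebesgue_cons (lebesgue_rV n')
  end.
End lebesgue.

Section euclid.
Context (R : realType) (d : nat).
Local Notation pt := 'rV[R]_d.

Definition dot (x y : pt) : R := \sum_(a < d) x 0 a * y 0 a.
(* The library norm on 'rV[R]_d is the sup norm. *)
Definition enorm (x : pt) : R := Num.sqrt (dot x x).
Definition diam (A : set pt) : R :=
  sup [set enorm (z.1 - z.2) | z in A `*` A].
Definition bd (A : set pt) : set pt := closure A `\` A^°.
Definition hyperplane (n : pt) (c : R) : set pt := [set x | dot n x = c].
Definition halfspace (n : pt) (c : R) : set pt := [set x | dot n x <= c].

Definition conv_hull (m : nat) (v : 'I_m -> pt) : set pt :=
  [set x | exists a : 'I_m -> R,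
    [/\ forall j, 0 <= a j, \sum_j a j = 1 & x = \sum_j a j *: v j]].

(* A contains k + 1 affinely independent points *)
Definition affine_dim_ge (A : set pt) (k : nat) : Prop :=
  exists (x0 : pt) (B : 'M[R]_(k, d)),
    [/\ A x0, forall j, A (x0 + row j B) & row_free B].
Definition affine_dim (A : set pt) (k : nat) : Prop :=
  affine_dim_ge A k /\ ~ affine_dim_ge A k.+1.

Lemma measurable_dot (n : pt) : measurable_fun setT (dot n).
Proof.
apply: measurable_sum => a; apply: measurable_funM => //.
exact: measurable_coord.
Qed.

Definition slab (n : pt) (c : R) : set pt := [set x | 0 <= dot n x - c <= 1].
Definition hproj (n : pt) (c : R) (x : pt) : pt := x - (dot n x - c) *: n.

Lemma measurable_slab n c : measurable (slab n c).
Proof.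
have -> : slab n c = setT `&` dot n @^-1` `[c, c + 1]%classic.
  rewrite setTI; apply/seteqP; split => x /=;
    by rewrite /slab/= in_itv/= subr_ge0 lerBlDl.
exact: measurable_dot.
Qed.

Lemma measurable_hproj n c : measurable_fun setT (hproj n c).
Proof.
apply: measurable_fun_rVP => a; under eq_fun do rewrite !mxE.
apply: measurable_funB; first exact: measurable_coord.
apply: measurable_funM => //; apply: measurable_funB => //.
exact: measurable_dot.
Qed.

(* For |n| = 1, the (d-1)-dimensional Lebesgue (equivalently, Hausdorff)
   measure carried by the hyperplane n . x = c: the measure of a subset A of
   the hyperplane is the volume of the right prism of base A and height 1. *)
Definition surface (n : pt) (c : R) : set pt -> \bar R := fun A =>
  lebesgue_rV R d (hproj n c @^-1` A `&` slab n c).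

Section surface_measure.
Context (n : pt) (c : R).
Let mpre A : measurable A -> measurable (hproj n c @^-1` A `&` slab n c).
Proof.
move=> mA; apply: measurableI; last exact: measurable_slab.
by rewrite -[X in measurable X]setTI; exact: measurable_hproj.
Qed.
Let s0 : surface n c set0 = 0%E.
Proof. by rewrite /surface preimage_set0 set0I measure0. Qed.
Let sp A : (0 <= surface n c A)%E. Proof. exact: measure_ge0. Qed.
Let sa : semi_sigma_additive (surface n c).
Proof.
move=> F mF tF mUF; rewrite /surface preimage_bigcup setI_bigcupl.
apply: measure_semi_sigma_additive.
- by move=> k; exact: mpre.
- apply/trivIsetP => /= i j _ _ ij; rewrite setIACA -preimage_setI.
  by move/trivIsetP : tF => /(_ _ _ _ _ ij) ->//; rewrite preimage_set0 set0I.
- by rewrite -setI_bigcupl -preimage_bigcup; exact: mpre.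
Qed.
HB.instance Definition _ := isMeasure.Build _ _ _ (surface n c) s0 sp sa.
End surface_measure.

End euclid.

Section element_shapes.
Context (R : realType) (d : nat).
Local Notation pt := 'rV[R]_d.

(* Number of vertices, and the list of facets given by their vertices *)
Definition triangle : nat * seq (seq nat) :=
  (3, [:: [:: 0; 1]; [:: 1; 2]; [:: 2; 0]])%N.
Definition quadrilateral : nat * seq (seq nat) :=
  (4, [:: [:: 0; 1]; [:: 1; 2]; [:: 2; 3]; [:: 3; 0]])%N.
Definition tetrahedron : nat * seq (seq nat) :=
  (4, [:: [:: 0; 1; 2]; [:: 0; 1; 3]; [:: 0; 2; 3]; [:: 1; 2; 3]])%N.
Definition prism : nat * seq (seq nat) :=
  (6, [:: [:: 0; 1; 2]; [:: 3; 4; 5];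
          [:: 0; 1; 4; 3]; [:: 1; 2; 5; 4]; [:: 2; 0; 3; 5]])%N.
Definition hexahedron : nat * seq (seq nat) :=
  (8, [:: [:: 0; 1; 2; 3]; [:: 4; 5; 6; 7]; [:: 0; 1; 5; 4];
          [:: 1; 2; 6; 5]; [:: 2; 3; 7; 6]; [:: 3; 0; 4; 7]])%N.

Definition shapes : seq (nat * seq (seq nat)) :=
  if d == 2 then [:: triangle; quadrilateral]
  else [:: tetrahedron; prism; hexahedron].

(* E is a convex polytope with the prescribed vertex-facet incidences *)
Definition has_shape (sh : nat * seq (seq nat)) (E : set pt) : Prop :=
  exists (v : 'I_sh.1 -> pt) (n : 'I_(size sh.2) -> pt)
         (c : 'I_(size sh.2) -> R),
    [/\ E = conv_hull v,
        E = [set x | forall f, dot (n f) x <= c f] &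
        forall f j, (dot (n f) (v j) == c f) =
                    (val j \in nth [::] sh.2 (val f))].

Definition element (E : set pt) : Prop :=
  exists2 sh, sh \in shapes & has_shape sh E.

End element_shapes.

Section weak_derivatives.
Context (R : realType) (d : nat).
Local Notation pt := 'rV[R]_d.
Local Notation leb := (lebesgue_rV R d).

Definition partial (a : 'I_d) (f : pt -> R) (x : pt) : R :=
  'D_(delta_mx 0 a : pt) f x.

(* C^1 test functions: the weak derivatives of L^2 functions are the same as
   with C^oo ones. *)
Definition C1 (f : pt -> R) : Prop :=
  (forall x, differentiable f x) /\ forall a, continuous (partial a f).

Definition test_function (O : set pt) (phi : pt -> R) : Prop :=
  C1 phi /\ exists K, [/\ compact K, K `<=` O & forall x, ~ K x -> phi x = 0].

Definition L2 (O : set pt) (f : pt -> R) : Prop :=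
  measurable_fun O f /\ leb.-integrable O (fun x => ((f x) ^+ 2)%:E).

Definition weak_gradient (O : set pt) (p : pt -> R) (g : pt -> pt) : Prop :=
  [/\ L2 O p, forall a, L2 O (fun x => g x 0 a) &
      forall a phi, test_function O phi ->
        \int[leb]_(x in O) (p x * partial a phi x)
        = - \int[leb]_(x in O) (g x 0 a * phi x)].

Definition weak_divergence (O : set pt) (u : pt -> pt) (g : pt -> R) : Prop :=
  [/\ forall a, L2 O (fun x => u x 0 a), L2 O g &
      forall phi, test_function O phi ->
        \int[leb]_(x in O) (\sum_a u x 0 a * partial a phi x)
        = - \int[leb]_(x in O) (g x * phi x)].

(* Symmetric positive definite, with uniform bounds k0, k1 *)
Definition permeability (O : set pt) (K : pt -> 'M[R]_d) : Prop :=
  (forall a b, measurable_fun O (fun x => K x a b)) /\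
  exists k0 k1 : R, 0 < k0 /\ forall x, O x -> (K x)^T = K x /\
    forall xi : pt, k0 * dot xi xi <= dot (xi *m K x) xi <= k1 * dot xi xi.

(* - K grad p, points and vectors being rows *)
Definition darcy_velocity (K : pt -> 'M[R]_d) (gradp : pt -> pt) (x : pt) : pt :=
  - (K x *m (gradp x)^T)^T.

Definition bounded_domain (O : set pt) : Prop :=
  [/\ open O, connected O, bounded_set O & O !=set0].

Definition boundary_parts (O GD GN : set pt) : Prop :=
  GD `&` GN = set0 /\ closure GD `|` closure GN = bd O.

End weak_derivatives.

Section mesh.
Context (R : realType) (d : nat).
Local Notation pt := 'rV[R]_d.
Local Notation leb := (lebesgue_rV R d).

(* The face k lies on the hyperplane normal k . x = offset k, with unit normal
   normal k exterior to the cell inner k; outer k is the cell on the other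
   side, None for a boundary face. *)
Record mesh := Mesh {
  ncells : nat;
  cell : 'I_ncells -> set pt;
  nfaces : nat;
  face : 'I_nfaces -> set pt;
  normal : 'I_nfaces -> pt;
  offset : 'I_nfaces -> R;
  inner : 'I_nfaces -> 'I_ncells;
  outer : 'I_nfaces -> option 'I_ncells;
  neumann : pred 'I_nfaces }.

Definition dirichlet (M : mesh) (k : 'I_(nfaces M)) : bool :=
  (outer k == None) && ~~ neumann k.

(* The face k is one of the faces forming the boundary of the cell i *)
Definition adjacent (M : mesh) (i : 'I_(ncells M)) (k : 'I_(nfaces M)) : bool :=
  (inner k == i) || (outer k == Some i).

(* GD, GN: Dirichlet and Neumann parts of the boundary of the domain O. The
   fields interior_face_all and boundary_face_all say that no face is omitted;
   cell_boundary makes every cell boundary the union of its faces, which may be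
   smaller than its facets (hanging nodes). *)
Record is_mesh (O GD GN : set pt) (M : mesh) : Prop := IsMesh {
  mesh_element : forall i : 'I_(ncells M), element (cell i);
  mesh_cover : closure O = \bigcup_(i : 'I_(ncells M)) cell i;
  mesh_inside : forall i : 'I_(ncells M), (cell i)^° `<=` O;
  mesh_disjoint : forall i j : 'I_(ncells M), i != j ->
    (cell i)^° `&` (cell j)^° = set0;
  face_inj : injective (@face M);
  face_dim : forall k : 'I_(nfaces M), affine_dim (face k) d.-1;
  face_unit : forall k : 'I_(nfaces M), enorm (normal k) = 1;
  face_plane : forall k : 'I_(nfaces M),
    face k `<=` hyperplane (normal k) (offset k);
  face_exterior : forall k : 'I_(nfaces M),
    cell (inner k) `<=` halfspace (normal k) (offset k);
  interior_face : forall (k : 'I_(nfaces M)) j, outer k = Some j ->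
    inner k != j /\ face k = cell (inner k) `&` cell j;
  interior_face_all : forall i j : 'I_(ncells M), i != j ->
    affine_dim (cell i `&` cell j) d.-1 ->
    exists k, (inner k = i /\ outer k = Some j) \/
              (inner k = j /\ outer k = Some i);
  boundary_face : forall k : 'I_(nfaces M), outer k = None ->
    face k = cell (inner k) `&` hyperplane (normal k) (offset k) /\
    face k `<=` bd O;
  boundary_face_all : forall (i : 'I_(ncells M)) (n : pt) (c : R),
    enorm n = 1 -> cell i `<=` halfspace n c ->
    affine_dim (cell i `&` hyperplane n c) d.-1 ->
    cell i `&` hyperplane n c `<=` bd O ->
    exists k, [/\ inner k = i, outer k = None &
                  face k = cell i `&` hyperplane n c];
  cell_boundary : forall i : 'I_(ncells M),
    bd (cell i) = \bigcup_(k in [set k | adjacent i k]) face k;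
  domain_boundary :
    bd O = \bigcup_(k in [set k : 'I_(nfaces M) | outer k = None]) face k;
  neumann_face : forall k : 'I_(nfaces M), neumann k ->
    outer k = None /\ face k `<=` closure GN;
  dirichlet_face : forall k : 'I_(nfaces M), dirichlet k ->
    face k `<=` closure GD }.

Definition mesh_size (M : mesh) : R := \big[Num.max/0]_i diam (@cell M i).

Definition shape_regular (rho : R) (M : mesh) : Prop :=
  forall i : 'I_(ncells M), exists x0 : pt,
    [set x | enorm (x - x0) < rho * diam (cell i)] `<=` (cell i)^°.

Definition quasi_uniform (tau : R) (M : mesh) : Prop :=
  forall i : 'I_(ncells M), mesh_size M / diam (cell i) <= tau.

Section on_mesh.
Variable M : mesh.

(* One function per face: the values on the null sets where closed faces
   overlap need not agree. *)
Definition face_fun : Type := 'I_(nfaces M) -> pt -> R.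
Definition P0 : Type := {ffun 'I_(ncells M) -> R}.

Definition face_measure (k : 'I_(nfaces M)) := surface (normal k) (offset k).
HB.instance Definition _ k := Measure.copy (face_measure k)
  (surface (normal k) (offset k)).

Definition L1_faces (v : face_fun) : Prop :=
  forall k, (face_measure k).-integrable (face k) (EFin \o v k).

Definition cell_normal (i : 'I_(ncells M)) (k : 'I_(nfaces M)) : pt :=
  if inner k == i then normal k else - normal k.

(* Integral of v n_F . n_E over the boundary of the cell i, see cell_boundary;
   distinct faces overlap in null sets only. *)
Definition boundary_flux (i : 'I_(ncells M)) (v : face_fun) : R :=
  \sum_(k | adjacent i k) \int[face_measure k]_(x in face k)
    (v k x * dot (normal k) (cell_normal i k)).

Definition volume (i : 'I_(ncells M)) : R := fine (leb (cell i)).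

Definition P0_proj (q : pt -> R) : P0 :=
  [ffun i => (volume i)^-1 * \int[leb]_(x in cell i) q x].

Definition discrete_div (v : face_fun) : P0 :=
  [ffun i => (volume i)^-1 * boundary_flux i v].

Definition residual (q : pt -> R) (v : face_fun) : P0 :=
  [ffun i => P0_proj q i - discrete_div v i].

Definition jump (w : P0) (k : 'I_(nfaces M)) : R :=
  w (inner k) - (if outer k is Some j then w j else 0).

Definition face_inner (G : pred 'I_(nfaces M)) (v w : face_fun) : R :=
  \sum_(k | G k) \int[face_measure k]_(x in face k) (v k x * w k x).

Definition cell_inner (v w : P0) : R :=
  \sum_i \int[leb]_(x in cell i) (v i * w i).

Definition face_norm (v : face_fun) : \bar R :=
  sqrte (\sum_k (mesh_size M)%:E *
    \int[face_measure k]_(x in face k) ((v k x) ^+ 2)%:E)%E.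

Definition correction_eq (omega : 'I_(nfaces M) -> R) (q : pt -> R)
    (Uh : face_fun) (y : P0) : Prop :=
  forall w : P0,
    face_inner (fun k => ~~ neumann k) (fun k _ => (omega k)^-1 * jump y k)
      (fun k _ => jump w k)
    = cell_inner (residual q Uh) w.

Definition corrected (omega : 'I_(nfaces M) -> R) (Uh : face_fun) (y : P0) :
    face_fun :=
  fun k x => if neumann k then Uh k x else Uh k x + (omega k)^-1 * jump y k.

Definition postprocessed omega q (Uh V : face_fun) : Prop :=
  exists2 y, correction_eq omega q Uh y & V = corrected omega Uh y.

Definition locally_conservative (q : pt -> R) (V : face_fun) : Prop :=
  forall i, boundary_flux i V = \int[leb]_(x in cell i) q x.

(* U = u . n_F on the faces, as the normal trace of a field of H(div): on
   every cell, Green's formula holds against C^1 functions. *)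
Definition normal_trace (O : set pt) (u : pt -> pt) (U : face_fun) : Prop :=
  L1_faces U /\ forall g, weak_divergence O u g ->
    forall i v, C1 v ->
      boundary_flux i (fun k x => U k x * v x)
      = \int[leb]_(x in cell i)
          (\sum_a u x 0 a * partial a v x + g x * v x).

(* T is the trace on the faces of the H^1 function p: (n_F)_a T is the normal
   trace of the field p e_a, whose divergence is the a-th derivative of p. *)
Definition trace (O : set pt) (p : pt -> R) (T : face_fun) : Prop :=
  L1_faces T /\ forall a,
    normal_trace O (fun x => p x *: delta_mx 0 a)
      (fun k x => T k x * normal k 0 a).

Definition dirichlet_condition (O GD : set pt) (p pB : pt -> R) : Prop :=
  exists2 T, trace O p T & forall k, dirichlet k ->
    {ae face_measure k, forall x, (face k `&` GD) x -> T k x = pB x}.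

Definition neumann_condition (GN : set pt) (U : face_fun) (uB : pt -> R) :
    Prop :=
  forall k, neumann k ->
    {ae face_measure k, forall x, (face k `&` GN) x -> U k x = uB x}.

Definition exact_on_neumann (U Uh : face_fun) : Prop :=
  forall k, neumann k ->
    {ae face_measure k, forall x, face k x -> Uh k x = U k x}.

End on_mesh.
End mesh.

(* Main.v *)
Require Import Defs.
From mathcomp Require Import all_boot all_order all_algebra.
From mathcomp Require Import all_classical all_reals all_analysis.
From mathcomp Require Import measurable_realfun ring lra.
Import numFieldNormedType.Exports.
Import Order.TTheory GRing.Theory Num.Theory.
Local Open Scope classical_set_scope.
Local Open Scope ring_scope.

(** Write [a_F] for the correction [omega_F^-1 [y]_F], and [e = U - U_h] for the
    error of the given flux. Everything rests on summation by parts
    ([sum_boundary_flux]): the sum over the cells of [w_E] times the flux of [v]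
    out of [E] is the sum over the faces of [[w]_F] times the integral of [v].

    Local conservation is the equation for [y] tested with the indicator function
    of a cell ([corrected_locally_conservative]).

    The equation is a square linear system whose matrix is that of the quadratic
    form [sum_F omega_F^-1 [y]_F^2 |F|] over the faces off the Neumann boundary.
    If this form vanishes at [y], so do the jumps on these faces, because faces
    have positive measure ([surface_gt0]). Then [y] is 0 on the cells of the
    Dirichlet faces, of which there is at least one, and the same value passes
    through interior faces. That it reaches all cells is the geometric core of
    the proof ([domain_cells_connected]): cells without a common face meet in a
    set of codimension two, and sets of codimension two do not disconnect the
    connected domain. So the matrix is invertible ([correction_eq_unique_ex]).

    For the convergence order, the exact flux is locally conservative too, by
    Green's formula, and the error on the Neumann boundary is zero. Tested with
    [y], the equation then says that the correction [a] is orthogonal to [e - a],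
    the error of the corrected flux, for the [L^2] product weighted by [omega]
    ([correction_orthogonal]). By Pythagoras, the weighted norm of the error
    does not increase, and comparison with the unweighted norm costs the factor
    [sqrt (omega1 / omega0)], which does not depend on the mesh
    ([corrected_error_le]). *)

Set Implicit Arguments.
Unset Strict Implicit.
Unset Printing Implicit Defensive.

(** * Continuity, and the dot product *)

Section near.
Context (R : realType) (T : topologicalType).
Implicit Types (f g : T -> R) (t : T).

Lemma near_gt0 f t : {for t, continuous f} -> 0 < f t ->
  \forall s \near t, 0 < f s.
Proof. by move=> fc ft; apply: (cvgr_gt (f t)). Qed.

Lemma near_forall (J : finType) (P : J -> T -> Prop) t :
  (forall j, \forall s \near t, P j s) -> \forall s \near t, forall j, P j s.
Proof. exact: filter_forall. Qed.

Lemma near_and (P Q : T -> Prop) t : (\forall s \near t, P s) ->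
  (\forall s \near t, Q s) -> \forall s \near t, P s /\ Q s.
Proof. exact: filterI. Qed.

Lemma continuous_subr f g t : {for t, continuous f} -> {for t, continuous g} ->
  {for t, continuous (fun s => f s - g s)}.
Proof. exact: cvgB. Qed.

Lemma continuous_sum (J : finType) (F : J -> T -> R) t :
  (forall j, {for t, continuous (F j)}) ->
  {for t, continuous (fun s => \sum_j F j s)}.
Proof.
move=> Fc; rewrite (_ : (fun s => _) = \sum_j F j); last first.
  by apply/funext => s; rewrite fct_sumE.
elim/big_ind : _ => [|f g fc gc|j _]; last exact: Fc.
- exact: cvg_cst.
- exact: cvgD.
Qed.

Lemma continuous_homothety (V : normedModType R) (x : V) s :
  continuous (fun w => x + s *: (w - x)).
Proof.
move=> w; apply: cvgD; first exact: cvg_cst.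
by apply: cvgZl_tmp; apply: cvgB; [exact: cvg_id|exact: cvg_cst].
Qed.

End near.

Section dot.
Context (R : realType) (d : nat).
Implicit Types x y n : 'rV[R]_d.

Lemma dotDr n x y : dot n (x + y) = dot n x + dot n y.
Proof.
by rewrite /dot -big_split; apply: eq_bigr => a _ /=; rewrite mxE mulrDr.
Qed.

Lemma dotZr n t x : dot n (t *: x) = t * dot n x.
Proof.
by rewrite /dot mulr_sumr; apply: eq_bigr => a _; rewrite mxE mulrCA.
Qed.

Lemma dotNr n x : dot n (- x) = - dot n x.
Proof. by rewrite -scaleN1r dotZr mulN1r. Qed.

Lemma dotBr n x y : dot n (x - y) = dot n x - dot n y.
Proof. by rewrite dotDr dotNr. Qed.

Lemma dot_sumr n m (a : 'I_m -> R) (v : 'I_m -> 'rV[R]_d) :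
  dot n (\sum_j a j *: v j) = \sum_j a j * dot n (v j).
Proof.
elim/big_ind2 : _ => [|x1 r1 x2 r2 <- <-|j _]; last by rewrite dotZr.
- by rewrite -(scale0r 0) dotZr mul0r.
- exact: dotDr.
Qed.

Lemma dotC x y : dot x y = dot y x.
Proof. by apply: eq_bigr => a _; rewrite mulrC. Qed.

Lemma dotE x y : dot x y = (x *m y^T) 0 0.
Proof. by rewrite mxE; apply: eq_bigr => a _; rewrite mxE. Qed.

Lemma dot_ge0 x : 0 <= dot x x.
Proof. by apply: sumr_ge0 => a _; rewrite -expr2 sqr_ge0. Qed.

Lemma dot_eq0 x : dot x x = 0 -> x = 0.
Proof.
move=> /eqP; rewrite psumr_eq0; last by move=> a _; rewrite -expr2 sqr_ge0.
move=> /allP x0; apply/rowP => a; rewrite mxE; apply/eqP.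
by have := x0 a; rewrite mem_index_enum -expr2 sqrf_eq0; exact.
Qed.

Lemma dot_unit x : enorm x = 1 -> dot x x = 1.
Proof. by move=> x1; rewrite -(sqr_sqrtr (dot_ge0 x)) -/(enorm x) x1 expr1n. Qed.

Lemma continuous_dot n : continuous (dot n).
Proof.
move=> x; have Fc a : {for x, continuous (fun y : 'rV[R]_d => n 0 a * y 0 a)}.
  apply: (@continuousM _ _ (cst (n 0 a)) (fun y : 'rV[R]_d => y 0 a)).
    exact: cst_continuous.
  exact: coord_continuous.
exact: (continuous_sum Fc).
Qed.

Lemma ball_coord x r y : ball x r y <-> 0 < r /\ forall j, `|x 0 j - y 0 j| < r.
Proof.
split=> -[r0 xy]; split=> //.
  by move=> j; exact: xy.
by move=> i j; rewrite (ord1 i); exact: xy.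
Qed.

Lemma le_coord_norm x j : `|x 0 j| <= `|x|.
Proof.
rewrite [leRHS]/Num.norm /= mx_normrE.
exact: (@le_bigmax _ _ _ _ (fun ij : 'I_1 * 'I_d => `|x ij.1 ij.2|) (0, j)).
Qed.

End dot.

(** * Closed convex sets *)

Section convexity.
Context (R : realType) (d : nat).
Local Notation pt := 'rV[R]_d.

(** Stability under all finite convex combinations, so that simplices are
    reached in one step. *)
Definition hull_stable (A : set pt) : Prop :=
  forall m (v : 'I_m -> pt), (forall j, A (v j)) -> conv_hull v `<=` A.

Lemma hull_stableI A B : hull_stable A -> hull_stable B -> hull_stable (A `&` B).
Proof.
move=> hA hB m v vAB x vx.
by split; [apply: hA vx|apply: hB vx] => j; case: (vAB j).
Qed.

Lemma hull_stable_preimage A (f : pt -> pt) :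
  (forall m (a : 'I_m -> R) v, \sum_j a j = 1 ->
     f (\sum_j a j *: v j) = \sum_j a j *: f (v j)) ->
  hull_stable A -> hull_stable (f @^-1` A).
Proof.
move=> fE hA m v vA x [a [a0 a1 ->]] /=; rewrite fE//.
by apply: (hA m (f \o v)) => //; exists a.
Qed.

Lemma hull_stable_segment A x y t : hull_stable A -> A x -> A y ->
  0 <= t <= 1 -> A (x + t *: (y - x)).
Proof.
move=> hA Ax Ay /andP[t0 t1].
apply: (hA 2%N (fun j => if j == 0 then x else y)); first by move=> j; case: ifP.
exists (fun j => if j == 0 then 1 - t else t); split.
- by move=> j; case: ifP; rewrite ?subr_ge0.
- by rewrite big_ord_recl big_ord1 /= subrK.
- rewrite big_ord_recl big_ord1 /= scalerBr scalerBl scale1r.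
  by rewrite [RHS]addrAC addrA.
Qed.

Lemma conv_hull_vertex m (v : 'I_m -> pt) j : conv_hull v (v j).
Proof.
exists (fun k => (k == j)%:R); split=> [k||].
- by rewrite ler0n.
- by rewrite (bigD1 j)//= eqxx big1 ?addr0// => k /negbTE ->.
- rewrite (bigD1 j)//= eqxx scale1r big1 ?addr0// => k /negbTE ->.
  by rewrite scale0r.
Qed.

(** What all cells and faces share, and finite intersections preserve. *)
Definition closed_convex (A : set pt) : Prop :=
  [/\ closed A, measurable A & hull_stable A].

Lemma closed_convexI A B :
  closed_convex A -> closed_convex B -> closed_convex (A `&` B).
Proof.
move=> [cA mA hA] [cB mB hB].
by split; [exact: closedI|exact: measurableI|exact: hull_stableI].
Qed.

Lemma closed_convex_halfspaces m (n : 'I_m -> pt) (c : 'I_m -> R) :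
  closed_convex [set x | forall f, dot (n f) x <= c f].
Proof.
have -> : [set x | forall f, dot (n f) x <= c f] =
    \bigcap_(f in [set: 'I_m]) (dot (n f) @^-1` [set r | r <= c f]).
  by apply/seteqP; split=> x /= H f; [move=> _|]; exact: H.
split.
- apply: closed_bigI => f _; apply: preimage_closed; last exact: closed_le.
  by move=> x _; exact: continuous_dot.
- apply: fin_bigcap_measurable => // f _.
  have -> : [set r | r <= c f] = `]-oo, c f]%classic.
    by apply/seteqP; split=> x /=; rewrite in_itv.
  rewrite -[X in measurable X]setTI; exact: measurable_dot.
- move=> k v vA x [a [a0 a1 ->]] f _ /=.
  rewrite dot_sumr -[leRHS]mul1r -a1 mulr_suml; apply: ler_sum => j _.
  by rewrite ler_wpM2l//; exact: vA.
Qed.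

Lemma closed_convex_hyperplane n c : closed_convex (hyperplane n c : set pt).
Proof.
suff -> : hyperplane n c = [set x | forall f : 'I_2,
    dot (if f == 0 then n else - n) x <= if f == 0 then c else - c].
  exact: closed_convex_halfspaces.
have dotNl x : dot (- n) x = - dot n x by rewrite dotC dotNr dotC.
apply/seteqP; split=> x /= => [H f|H]; first by case: ifP; rewrite ?dotNl H.
apply/eqP; rewrite eq_le (H 0)/=.
by have := H 1; rewrite /= dotNl lerN2.
Qed.

(** A simplex with [d + 1] affinely independent vertices is the set of the
    points with nonnegative barycentric coordinates, and its barycentre has
    positive ones. *)
Lemma simplex_interior A k x0 (B : 'M[R]_(k, d)) : k = d -> hull_stable A ->
  A x0 -> (forall j, A (x0 + row j B)) -> row_free B -> A^° !=set0.
Proof.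
move=> kd; subst k => hA Ax0 AB; rewrite row_free_unit => Bu.
pose g (x : pt) : pt := (x - x0) *m invmx B.
have gE j x : g x 0 j = dot (col j (invmx B))^T x - dot (col j (invmx B))^T x0.
  by rewrite -dotBr mxE; apply: eq_bigr => i _; rewrite !mxE mulrC.
have gc j x : {for x, continuous (fun y => g y 0 j)}.
  rewrite (_ : (fun y => _) =
    (fun y => dot (col j (invmx B))^T y - dot (col j (invmx B))^T x0)).
    by apply: continuous_subr; [exact: continuous_dot|exact: cst_continuous].
  by apply/funext => y; exact: gE.
have gA x : (forall j, 0 <= g x 0 j) -> 0 <= 1 - \sum_j g x 0 j -> A x.
  move=> g0 g1.
  pose v (k : 'I_d.+1) := if unlift ord0 k is Some j then x0 + row j B else x0.
  apply: (hA _ v); first by move=> k; rewrite /v; case: unlift.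
  exists (fun k => if unlift ord0 k is Some j then g x 0 j
                   else 1 - \sum_j g x 0 j); split.
  - by move=> k; case: unlift.
  - rewrite big_ord_recl unlift_none; under [X in _ + X = _]eq_bigr do rewrite liftK.
    by rewrite subrK.
  - rewrite big_ord_recl /v unlift_none.
    under [X in _ = _ + X]eq_bigr do rewrite liftK scalerDr.
    rewrite big_split /= -scaler_suml addrA -scalerDl subrK scale1r.
    have -> : \sum_j g x 0 j *: row j B = g x *m B by rewrite mulmx_sum_row.
    by rewrite mulmxKV// addrC subrK.
pose e : R := d.+1%:R^-1.
pose p : pt := x0 + const_mx e *m B.
have gp j : g p 0 j = e by rewrite /g /p addrC addKr mulmxK// mxE.
have g_near : \forall x \near p, forall j, 0 < g x 0 j.
  by apply: near_forall => j; apply: near_gt0 (gc j p) _; rewrite gp invr_gt0.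
have s_near : \forall x \near p, 0 < 1 - \sum_j g x 0 j.
  apply: (@near_gt0 _ _ (fun x => 1 - \sum_j g x 0 j)).
    apply: continuous_subr; first exact: cst_continuous.
    exact: (continuous_sum (fun j => gc j p)).
  under eq_bigr do rewrite gp.
  rewrite sumr_const card_ord -mulr_natl /e subr_gt0.
  by rewrite ltr_pdivrMr// mul1r ltr_nat.
exists p; rewrite /interior /=; have := near_and g_near s_near.
by apply: filterS => x [g0 g1]; apply: gA => [j|]; exact: ltW.
Qed.

(** The homothety of centre [x] moves a neighbourhood of an interior point
    arbitrarily close to [x]. *)
Lemma convex_interior_near A z x V : hull_stable A -> A^° z -> A x ->
  nbhs x V -> exists2 y, V y & A^° y.
Proof.
move=> hA Az Ax /nbhs_ballP[r /= r0 rV].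
pose t := r / (`|z - x| + r).
have D0 : 0 < `|z - x| + r by rewrite ltr_wpDl.
have t0 : 0 < t by rewrite divr_gt0.
have t1 : t <= 1 by rewrite ler_pdivrMr// mul1r lerDr.
exists (x + t *: (z - x)).
  apply: rV; rewrite -ball_normE /ball_ /= opprD addrA subrr add0r normrN normrZ.
  rewrite gtr0_norm// /t mulrAC ltr_pdivrMr// ltr_pM2l//.
  by rewrite ltrDl.
pose h (w : pt) := x + t^-1 *: (w - x).
have hc : {for x + t *: (z - x), continuous h}.
  exact: continuous_homothety.
have hz : h (x + t *: (z - x)) = z.
  by rewrite /h addrAC subrr add0r scalerA mulVf ?gt_eqF// scale1r subrKC.
have : \forall w \near x + t *: (z - x), A (h w).
  by have := hc A; rewrite hz => /(_ Az).
rewrite /interior /=; apply: filterS => w Ahw.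
have -> : w = x + t *: (h w - x).
  by rewrite /h addrAC subrr add0r scalerA divff ?gt_eqF// scale1r subrKC.
by apply: hull_stable_segment => //; rewrite ltW.
Qed.

End convexity.
(** * Small sets do not disconnect a domain *)

Lemma connected_meet (T : topologicalType) (X A B : set T) :
  connected X -> closed A -> closed B -> X `<=` A `|` B ->
  X `&` A !=set0 -> X `&` B !=set0 -> X `&` (A `&` B) !=set0.
Proof.
move=> Xc Acl Bcl XAB XA [b [Xb Bb]]; apply/set0P/negP => /eqP XAB0.
have : X `&` A = X.
  apply: Xc => //; last by exists A.
  exists (~` B); first by rewrite openC.
  apply/seteqP; split=> x [Xx].
    by move=> Ax; split=> // Bx; have : set0 x by rewrite -XAB0.
  by move=> nBx; split=> //; case: (XAB _ Xx).
move=> /seteqP[_ /(_ _ Xb)[_ Ab]].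
by have : set0 b by rewrite -XAB0.
Qed.

Section connectivity.
Context (R : realType) (d : nat).
Local Notation pt := 'rV[R]_d.

(** Independent vectors are collected one at a time, as long as some element of
    [S] lies outside the span of those already chosen. *)
Lemma independent_or_spanned (S : set pt) k :
  (exists2 B : 'M[R]_(k, d), row_free B & forall j, S (row j B)) \/
  (exists j (B : 'M[R]_(j, d)), (j < k)%N /\ forall s, S s -> (s <= B)%MS).
Proof.
elim: k => [|k [[B fB SB]|[j [B [jk SB]]]]].
- left; exists 0; last by case.
  by rewrite /row_free mxrank0.
- have [Ssub|] := pselect (forall s, S s -> (s <= B)%MS).
    by right; exists k, B.
  move=> /existsNP[s /not_implyP[Ss /negP sB]]; left.
  rewrite -[k.+1]/(1 + k)%N; exists (col_mx s B).
    have s0 : s != 0 by apply: contraNneq sB => ->; exact: sub0mx.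
    have rs : \rank s = 1%N by apply/eqP; rewrite rank_rV s0.
    rewrite /row_free -addsmxE mxrank_disjoint_sum.
      by rewrite rs (eqP fB).
    apply/eqP; rewrite -mxrank_eq0 -leqn0 -ltnS.
    have := mxrankS (capmxSl s B); rewrite rs leq_eqVlt => /orP[/eqP r1|//].
    case/negP: sB; apply: submx_trans (capmxSr s B).
    by rewrite -(mxrank_leqif_sup (capmxSl s B)) r1 rs.
  by move=> j; case: (split_ordP j) => i ->; rewrite ?rowKu ?rowKd ?row_id// (ord1 i).
- by right; exists j, B; split=> //; exact: ltnW.
Qed.

(** Such a [D] lies in an affine subspace of codimension two, which spans at most
    a hyperplane together with [a]. *)
Lemma low_dim_hyperplane (D : set pt) a : (0 < d)%N ->
  ~ affine_dim_ge D d.-1 ->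
  exists2 n : pt, n != 0 & forall z, D z -> dot n (z - a) = 0.
Proof.
move=> d0 Ddim.
have dnz : exists n : pt, n != 0.
  exists (const_mx 1); apply/eqP => /rowP/(_ (Ordinal d0)) /eqP.
  by rewrite !mxE oner_eq0.
have [[z0 Dz0]|D0] := pselect (D !=set0); last first.
  by have [n n0] := dnz; exists n => // z Dz; case: D0; exists z.
have [[B fB DB]|[j [B [jd DB]]]] :=
    independent_or_spanned [set z | D (z0 + z)] d.-1.
  by case: Ddim; exists z0, B.
pose C := col_mx (z0 - a) B.
have : kermx C^T != 0.
  rewrite kermx_eq0 /row_free mxrank_tr neq_ltn (leq_ltn_trans (rank_leq_row C))//.
  by rewrite add1n (leq_ltn_trans jd)// ltn_predL.
move=> /rowV0Pn[n /sub_kermxP nC n0]; exists n => // z Dz.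
have nC0 : C *m n^T = 0 by rewrite -[LHS]trmxK trmx_mul trmxK nC trmx0.
have : (z - a <= C)%MS.
  rewrite -[z](subrK z0) -addrA addmx_sub// /C -addsmxE.
    by apply: submx_trans (addsmxSr _ _); apply: DB; rewrite /= subrKC.
  exact: addsmxSl.
by case/submxP => E ->; rewrite dotC dotE -mulmxA nC0 mulmx0 mxE.
Qed.

Lemma dense_hyperplaneC (n a : pt) : n != 0 ->
  open [set x | dot n (x - a) != 0] /\ dense [set x | dot n (x - a) != 0].
Proof.
move=> n0; have nn : dot n n != 0 by apply: contraNneq n0 => /dot_eq0 ->.
split.
  have -> : [set x | dot n (x - a) != 0] =
      ~` (dot n @^-1` [set r | r <= dot n a] `&` dot n @^-1` [set r | dot n a <= r]).
    apply/seteqP; split=> x /=; rewrite dotBr subr_eq0.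
      by move=> nx [x1 x2]; case/negP: nx; rewrite eq_le x1.
    by move=> H; apply/eqP => E; apply: H; rewrite E.
  rewrite openC; apply: closedI; apply: preimage_closed;
    by [move=> x _; exact: continuous_dot|exact: closed_le|exact: closed_ge].
move=> W [x Wx] Wo; have [nx|] := eqVneq (dot n (x - a)) 0; last first.
  by move=> nx; exists x.
have /nbhs_ballP[r /= r0 rW] : nbhs x W by rewrite nbhsE; exists W.
have D0 : 0 < `|n| + 1 by rewrite ltr_wpDl.
pose t := r / (`|n| + 1); have t0 : 0 < t by rewrite divr_gt0.
exists (x + t *: n); split.
  apply: rW; rewrite -ball_normE /ball_ /= opprD addrA subrr add0r normrN normrZ.
  by rewrite gtr0_norm// /t mulrAC ltr_pdivrMr// ltr_pM2l// ltrDl.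
by rewrite /= addrAC dotDr nx add0r dotZr mulf_neq0// gt_eqF.
Qed.

Lemma dense_seq (T : eqType) (s : seq T) (G : T -> set pt) :
  (forall i, open (G i) /\ dense (G i)) ->
  open [set x | forall i, i \in s -> G i x] /\
  dense [set x | forall i, i \in s -> G i x].
Proof.
move=> HG; elim: s => [|i s [so sd]].
  rewrite (_ : [set _ | _] = setT); last by apply/seteqP; split.
  by split; [exact: openT|move=> W [x Wx] _; exists x].
have -> : [set x | forall j, j \in i :: s -> G j x] =
    G i `&` [set x | forall j, j \in s -> G j x].
  apply/seteqP; split=> x /= => [H|[Gx H] j].
    by split=> [|j js]; apply: H; rewrite inE ?eqxx// js orbT.
  by rewrite inE => /predU1P[->//|]; exact: H.
have [io id] := HG i.
by split; [exact: openI|exact: denseI].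
Qed.

Lemma segment_path_connected (V : normedModType R) (a b : V) :
  connected [set a + t *: (b - a) | t in `[0, 1]%classic].
Proof.
apply: connected_continuous_connected; first exact: segment_connected.
apply: continuous_subspaceT => t; apply: cvgD; first exact: cvg_cst.
by apply: cvgZr_tmp; exact: cvg_id.
Qed.

Lemma ball_segment (V : normedModType R) (x a b : V) r t :
  ball x r a -> ball x r b -> 0 <= t <= 1 -> ball x r (a + t *: (b - a)).
Proof.
rewrite -ball_normE /ball_ /= => xa xb /andP[t0 t1].
have -> : x - (a + t *: (b - a)) = (1 - t) *: (x - a) + t *: (x - b).
  rewrite opprD addrA -scalerN opprB scalerBl scale1r -[RHS]addrA; congr (_ + _).
  by rewrite -scalerN -scalerDr opprB addrA subrK.
apply: le_lt_trans (ler_normD _ _) _; rewrite !normrZ !ger0_norm ?subr_ge0//.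
have : t * `|x - b| <= t * r by rewrite ler_wpM2l// ltW.
have : (1 - t) * `|x - a| <= (1 - t) * r by rewrite ler_wpM2l ?subr_ge0// ltW.
move: t0; rewrite le_eqVlt => /predU1P[<-|t0]; first by rewrite subr0 !mul1r !mul0r addr0.
have : t * `|x - b| < t * r by rewrite ltr_pM2l.
lra.
Qed.

(** A cell in [S] and a cell outside it meet in a set of codimension two, which
    a generic segment avoids. If [S] were a proper subset of the cells, the
    domain would meet both the union of the cells in [S] and the union of the
    others in some common point. Around it, a generic segment from the interior
    of a cell in [S] to the interior of a cell outside [S] stays in the domain
    and avoids the common points of the two unions: this contradicts the
    connectedness of the segment. *)
Lemma domain_cells_connected (O : set pt) n (C : 'I_n -> set pt) (S : pred 'I_n) :
  (0 < d)%N -> open O -> connected O -> O `<=` \bigcup_(i : 'I_n) C i ->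
  (forall i, closed (C i)) -> (forall i, hull_stable (C i)) ->
  (forall i, (C i)^° !=set0) -> (forall i, (C i)^° `<=` O) ->
  (forall i j, i != j -> (C i)^° `&` (C j)^° = set0) ->
  (forall i j, S i -> ~~ S j -> ~ affine_dim_ge (C i `&` C j) d.-1) ->
  forall i j, S i -> S j.
Proof.
move=> d0 Oo Oc OC Ccl Ch Ci CO Cdisj CS i0 j0 Si0; apply/negPn/negP => Sj0.
pose A := \bigcup_(i in [set i | S i]) C i.
pose B := \bigcup_(i in [set i | ~~ S i]) C i.
have Acl : closed A by apply: closed_bigcup => //; exact: finite_finset.
have Bcl : closed B by apply: closed_bigcup => //; exact: finite_finset.
have OAB : O `<=` A `|` B.
  move=> x /OC[i _ Cx]; have [Si|nSi] := boolP (S i).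
    by left; exists i.
  by right; exists i.
have meets i : exists2 x, O x & C i x.
  by have [x Cx] := Ci i; exists x; [exact: CO Cx|exact: interior_subset Cx].
have [||x [Ox [[i /= Si Cix] [j /= Sj Cjx]]]] := connected_meet Oc Acl Bcl OAB.
- by have [x Ox Cx] := meets i0; exists x; split=> //; exists i0.
- by have [x Ox Cx] := meets j0; exists x; split=> //; exists j0.
have /nbhs_ballP[r /= r0 rO] : nbhs x O by rewrite nbhsE; exists O.
have xr : nbhs x (ball x r) by apply/nbhs_ballP; exists r.
have [zi Czi] := Ci i; have [zj Czj] := Ci j.
have [a ra Ca] := convex_interior_near (Ch i) Czi Cix xr.
have /choice[G HG] : forall ij : 'I_n * 'I_n, exists G : set pt,
    (open G /\ dense G) /\ (S ij.1 -> ~~ S ij.2 -> forall b, G b ->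
      forall t, C ij.1 (a + t *: (b - a)) -> C ij.2 (a + t *: (b - a)) -> t = 0).
  move=> [i' j'] /=; have [Si'|] := boolP (S i'); last first.
    by exists setT; split=> //; split; [exact: openT|move=> W [y Wy] _; exists y].
  have [|Sj'] := boolP (S j').
    by exists setT; split=> //; split; [exact: openT|move=> W [y Wy] _; exists y].
  have [m m0 mC] := low_dim_hyperplane a d0 (CS _ _ Si' Sj').
  exists [set y | dot m (y - a) != 0]; split; first exact: dense_hyperplaneC.
  move=> _ _ b /= /negP mb t C1 C2; apply/eqP/negPn/negP => t0; apply: mb.
  have := mC _ (conj C1 C2); rewrite addrC addKr dotZr => /eqP.
  by rewrite mulf_eq0 (negbTE t0).
have [_ Gd] := dense_seq (index_enum _) (fun ij => (HG ij).1).
have [b [[rb Cb] Gb]] : (ball x r)^° `&` (C j)^° `&`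
    [set y | forall ij, ij \in index_enum _ -> G ij y] !=set0.
  apply: Gd; last by apply: openI; exact: open_interior.
  have [b rb Cb] := convex_interior_near (Ch j) Czj Cjx
    (nbhs_interior xr : nbhs x (ball x r)^°).
  by exists b.
have [|||y [[t /= t01 <-{y}] [[i' /= Si' Ci'] [j' /= Sj' Cj']]]] :=
  connected_meet (@segment_path_connected _ a b) Acl Bcl.
- move=> _ [t /= t01 <-]; apply: OAB; apply: rO; apply: ball_segment => //.
  exact: interior_subset rb.
- exists a; split; last by exists i => //; exact: interior_subset Ca.
  by exists 0; rewrite ?scale0r ?addr0//= in_itv/= lexx ler01.
- exists b; split; last by exists j => //; exact: interior_subset Cb.
  by exists 1; rewrite ?scale1r ?subrKC//= in_itv/= lexx ler01.
have t0 : t = 0.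
  by apply: ((HG (i', j')).2 Si' Sj' b (Gb _ _) _ Ci' Cj'); rewrite mem_index_enum.
have Cja : C j' a by move: Cj'; rewrite t0 scale0r addr0.
have [zj' Czj'] := Ci j'.
have [y Ciy Cjy] := convex_interior_near (Ch j') Czj' Cja
  (nbhs_interior Ca : nbhs a (C i)^°).
have ij' : i != j' by apply: contraNneq Sj' => <-.
by have : set0 y by rewrite -(Cdisj _ _ ij').
Qed.

End connectivity.

(** * Positive and finite volumes *)

Section volumes.
Context (R : realType).

Lemma measurable_ball_rV d (c : 'rV[R]_d) r : measurable (ball c r).
Proof.
have [r0|r0] := ltP 0 r; last first.
  rewrite (_ : ball c r = set0) //; apply/seteqP; split=> // x /ball_coord[].
  by move=> /lt_le_trans/(_ r0); rewrite ltxx.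
have -> : ball c r = \bigcap_(j in [set: 'I_d])
    ((fun x : 'rV[R]_d => (x 0 j : measurableTypeR R)) @^-1` ball (c 0 j) r).
  apply/seteqP; split=> x.
    by move=> /ball_coord[_ xc] j _; exact: xc.
  by move=> xc; apply/ball_coord; split=> // j; exact: xc.
apply: fin_bigcap_measurable => // j _; rewrite -[X in measurable X]setTI.
by apply: measurable_coord => //; exact: measurable_realfun.measurable_ball.
Qed.

Lemma lebesgue_rV_ball d (c : 'rV[R]_d) r : 0 < r ->
  lebesgue_rV R d (ball c r) = ((r *+ 2) ^+ d)%:E.
Proof.
move=> r0; elim: d c => [c|d IH c].
  by rewrite /= diracE mem_set ?expr0//; apply/ball_coord; split=> // -[].
pose tl : 'rV[R]_d := \row_j c 0 (lift 0 j).
rewrite /= /lebesgue_cons /pushforward.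
have -> : @rV_cons R d @^-1` ball c r = ball (c 0 0) r `*` ball tl r.
  apply/seteqP; split=> z /=.
    move=> /ball_coord[_ cz]; split.
      by have := cz 0; rewrite rV_cons0.
    by apply/ball_coord; split=> // j; have := cz (lift 0 j); rewrite rV_consS mxE.
  move=> [z1 /ball_coord[_ z2]]; apply/ball_coord; split=> // j.
  case: (unliftP 0 j) => [i|] ->; first by have := z2 i; rewrite rV_consS mxE.
  by rewrite rV_cons0.
rewrite product_measure1E; last exact: measurable_ball_rV.
  rewrite IH exprS EFinM; congr (_ * _)%E.
  exact: lebesgue_measure_ball (ltW r0).
exact: measurable_realfun.measurable_ball.
Qed.

Lemma lebesgue_rV_gt0 d (A : set 'rV[R]_d) : measurable A -> A^° !=set0 ->
  (0 < lebesgue_rV R d A)%E.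
Proof.
move=> mA [x /nbhs_ballP[r /= r0 rA]].
apply: (@lt_le_trans _ _ (lebesgue_rV R d (ball x r))).
  by rewrite lebesgue_rV_ball// lte_fin exprn_gt0// pmulrn_lgt0.
by apply: le_measure => //; rewrite inE//; exact: measurable_ball_rV.
Qed.

Definition norm_bounded d (A : set 'rV[R]_d) : Prop :=
  exists r : R, forall x, A x -> `|x| <= r.

Lemma lebesgue_rV_fin d (A : set 'rV[R]_d) : measurable A -> norm_bounded A ->
  (lebesgue_rV R d A < +oo)%E.
Proof.
move=> mA [r Ar]; have r0 : 0 < `|r| + 1 by rewrite ltr_wpDl.
apply: (@le_lt_trans _ _ (lebesgue_rV R d (ball 0 (`|r| + 1)))).
  apply: le_measure; rewrite ?inE//; first exact: measurable_ball_rV.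
  move=> x /Ar xr; rewrite -ball_normE /ball_ /= sub0r normrN.
  by rewrite (le_lt_trans xr)// (le_lt_trans (ler_norm r))// ltrDl.
by rewrite lebesgue_rV_ball// ltry.
Qed.

Section surface.
Context (d : nat) (n : 'rV[R]_d) (c : R).
Context (n1 : enorm n = 1).

Let nn : dot n n = 1. Proof. exact: dot_unit. Qed.

Let hprojK x v t : dot n x = c -> dot n v = 0 -> hproj n c (x + v + t *: n) = x + v.
Proof.
move=> xc v0; rewrite /hproj !dotDr dotZr xc v0 nn.
by rewrite addr0 mulr1 [c + t]addrC !addrK.
Qed.

(** The prism of height 1 over a convex subset of the hyperplane that contains
    [d] affinely independent points is convex and contains, together with the
    tip of the normal, [d + 1] such points. *)
Lemma surface_gt0 (F : set 'rV[R]_d) : (0 < d)%N -> measurable F ->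
  hull_stable F -> F `<=` hyperplane n c -> affine_dim_ge F d.-1 ->
  (0 < surface n c F)%E.
Proof.
move=> d0 mF hF Fn [x0 [B [Fx0 FB fB]]]; apply: lebesgue_rV_gt0.
  apply: measurableI; last exact: measurable_slab.
  by rewrite -[X in measurable X]setTI; exact: measurable_hproj.
have x0c : dot n x0 = c by exact: Fn.
have Bn j : dot n (row j B) = 0.
  by have : dot n (x0 + row j B) = c := Fn _ (FB j); rewrite dotDr x0c => /eqP;
    rewrite -subr_eq0 addrAC subrr add0r => /eqP.
have hP : hull_stable (hproj n c @^-1` F `&` slab n c).
  apply: hull_stableI.
    apply: hull_stable_preimage => // m a v a1.
    rewrite /hproj dot_sumr (_ : _ - c = \sum_j a j * (dot n (v j) - c)).
      rewrite scaler_suml -sumrB; apply: eq_bigr => j _.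
      by rewrite scalerBr scalerA.
    by under [RHS]eq_bigr do rewrite mulrBr; rewrite sumrB -mulr_suml a1 mul1r.
  move=> m v vS x [a [a0 a1 ->]]; rewrite /slab /= dot_sumr.
  have -> : \sum_j a j * dot n (v j) - c = \sum_j a j * (dot n (v j) - c).
    by under [RHS]eq_bigr do rewrite mulrBr; rewrite sumrB -mulr_suml a1 mul1r.
  apply/andP; split.
    by apply: sumr_ge0 => j _; case/andP: (vS j) => ? ?; rewrite mulr_ge0.
  rewrite -a1; apply: ler_sum => j _; case/andP: (vS j) => _ ?.
  by rewrite -[leRHS]mulr1 ler_wpM2l.
have inP v t : F (x0 + v) -> dot n v = 0 -> 0 <= t <= 1 ->
    (hproj n c @^-1` F `&` slab n c) (x0 + v + t *: n).
  move=> Fv nv t01; split; first by rewrite /= hprojK.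
  by rewrite /slab /= !dotDr dotZr nv nn x0c mulr1 addr0 addrAC subrr add0r.
apply: (@simplex_interior _ _ _ _ x0 (col_mx B n)) => //.
- by rewrite addn1 prednK.
- have := inP 0 0; rewrite scale0r !addr0; apply=> //; last by rewrite lexx ler01.
  by rewrite -(scale0r 0) dotZr mul0r.
- move=> j; case: (split_ordP j) => i ->; rewrite ?rowKu ?rowKd.
    have := inP (row i B) 0; rewrite scale0r addr0; apply=> //.
    by rewrite lexx ler01.
  have := inP 0 1; rewrite !addr0 scale1r row_id; apply=> //.
    by rewrite -(scale0r 0) dotZr mul0r.
  by rewrite lexx ler01.
- rewrite -kermx_eq0; apply/rowV0P => w /sub_kermxP.
  rewrite -[w]hsubmxK mul_row_col => wC.
  have w2 : rsubmx w = 0.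
    have := congr1 (fun v : 'rV[R]_d => dot n v) wC.
    rewrite dotDr mulmx_sum_row dot_sumr big1 ?add0r; last first.
      by move=> j _; rewrite Bn mulr0.
    rewrite [rsubmx w]mx11_scalar mul_scalar_mx dotZr nn mulr1 => ->.
    by rewrite -(scale0r 0) dotZr mul0r raddf0.
  move: wC; rewrite w2 mul0mx addr0 => wB.
  have -> : lsubmx w = 0.
    by apply: (row_free_inj fB); rewrite /= wB mul0mx.
  by rewrite row_mx0.
Qed.

Lemma surface_fin (F : set 'rV[R]_d) : measurable F -> norm_bounded F ->
  (surface n c F < +oo)%E.
Proof.
move=> mF [r Fr]; apply: lebesgue_rV_fin.
  apply: measurableI; last exact: measurable_slab.
  by rewrite -[X in measurable X]setTI; exact: measurable_hproj.
exists (r + `|n|) => x [/= Fx /andP[s0 s1]].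
rewrite -[x](subrK ((dot n x - c) *: n)) (le_trans (ler_normD _ _))// lerD//.
  exact: Fr.
by rewrite normrZ ger0_norm// ler_piMl.
Qed.

End surface.
End volumes.

(** * Cells and faces *)

Section elements.
Context (R : realType) (d : nat).
Local Notation pt := 'rV[R]_d.

Lemma conv_hull_bounded m (v : 'I_m -> pt) : norm_bounded (conv_hull v).
Proof.
exists (\sum_j `|v j|) => x [a [a0 a1 ->]].
apply: le_trans (ler_norm_sum _ _ _) _; apply: ler_sum => j _.
rewrite normrZ ger0_norm// ler_piMl// -a1 (bigD1 j)//= lerDl.
by apply: sumr_ge0 => i _.
Qed.

Lemma norm_boundedS (A B : set pt) : A `<=` B -> norm_bounded B -> norm_bounded A.
Proof. by move=> AB [r Br]; exists r => x /AB; exact: Br. Qed.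

Lemma enorm_le (x : pt) r : `|x| <= r -> enorm x <= Num.sqrt (d%:R * r ^+ 2).
Proof.
move=> xr; rewrite ler_wsqrtr// /dot -[d in d%:R]card_ord -sum1_card natr_sum.
rewrite mulr_suml; apply: ler_sum => j _.
rewrite mul1r -expr2 -[leLHS]real_normK ?num_real// lerXn2r ?nnegrE//.
  by rewrite (le_trans _ xr).
exact: le_trans (le_coord_norm x j) xr.
Qed.

Lemma enorm_gt0 (x : pt) : x != 0 -> 0 < enorm x.
Proof.
move=> x0; rewrite sqrtr_gt0 lt_neqAle dot_ge0 andbT eq_sym.
by apply: contraNneq x0 => /dot_eq0 ->.
Qed.

Lemma diam_gt0 (A : set pt) x y : norm_bounded A -> A x -> A y -> x != y ->
  0 < diam A.
Proof.
move=> [r Ar] Ax Ay xy; rewrite /diam.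
apply: (@lt_le_trans _ _ (enorm (x - y))); first by rewrite enorm_gt0// subr_eq0.
apply: ub_le_sup; last by exists (x, y).
exists (Num.sqrt (d%:R * (r + r) ^+ 2)) => _ [z [z1 z2] <-].
apply: enorm_le; rewrite (le_trans (ler_normB _ _))// lerD//; exact: Ar.
Qed.

Lemma closed_convex_element (E : set pt) : element E -> closed_convex E.
Proof.
by move=> [sh _ [v [n [c [_ -> _]]]]]; exact: closed_convex_halfspaces.
Qed.

Lemma element_bounded (E : set pt) : element E -> norm_bounded E.
Proof. by move=> [sh _ [v [n [c [-> _ _]]]]]; exact: conv_hull_bounded. Qed.

(** Two vertices differ as soon as the plane of some facet contains only one of
    them. The incidences are thus what rules out degenerate cells. *)
Lemma element_two_points (E : set pt) : element E ->
  exists x y, [/\ E x, E y & x != y].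
Proof.
move=> [sh shd [v [n [c [EE _ vn]]]]].
suff [f [j [k [fj fk]]]] : exists (f : 'I_(size sh.2)) (j k : 'I_sh.1),
    (val j \in nth [::] sh.2 (val f)) /\ (val k \notin nth [::] sh.2 (val f)).
  exists (v j), (v k); rewrite EE; split; [exact: conv_hull_vertex..|].
  by apply/eqP => vjk; move: fj fk; rewrite -!vn vjk => ->.
move: shd; rewrite /shapes; case: ifP => _; rewrite !inE => /orP[].
- move=> /eqP ->; exists (@Ordinal 3 0 isT), (@Ordinal 3 0 isT), (@Ordinal 3 2 isT).
  by [].
- move=> /eqP ->; exists (@Ordinal 4 0 isT), (@Ordinal 4 0 isT), (@Ordinal 4 2 isT).
  by [].
- move=> /eqP ->; exists (@Ordinal 4 0 isT), (@Ordinal 4 0 isT), (@Ordinal 4 3 isT).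
  by [].
move=> /orP[] /eqP ->.
  exists (@Ordinal 5 0 isT), (@Ordinal 6 0 isT), (@Ordinal 6 3 isT).
  by [].
exists (@Ordinal 6 0 isT), (@Ordinal 8 0 isT), (@Ordinal 8 4 isT).
by [].
Qed.

Lemma diam_element_gt0 (E : set pt) : element E -> 0 < diam E.
Proof.
move=> hE; have [x [y [Ex Ey xy]]] := element_two_points hE.
exact: diam_gt0 (element_bounded hE) Ex Ey xy.
Qed.

End elements.

Section mesh_geometry.
Context (R : realType) (d : nat) (hd : (0 < d)%N).
Context (Omega GammaD GammaN : set 'rV[R]_d) (M : mesh R d).
Context (hM : is_mesh Omega GammaD GammaN M).

Lemma cell_measurable i : measurable (cell (m := M) i).
Proof. by have [] := closed_convex_element (mesh_element hM i). Qed.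

Lemma face_sub_cell k : face (m := M) k `<=` cell (inner k).
Proof.
case E : (outer k) => [j|].
  by have [_ ->] := interior_face hM E; exact: subIsetl.
by have [-> _] := boundary_face hM E; exact: subIsetl.
Qed.

Lemma closed_convex_face k : closed_convex (face (m := M) k).
Proof.
case E : (outer k) => [j|].
  have [_ ->] := interior_face hM E.
  by apply: closed_convexI; apply: closed_convex_element; exact: mesh_element hM _.
have [-> _] := boundary_face hM E.
apply: closed_convexI; last exact: closed_convex_hyperplane.
by apply: closed_convex_element; exact: mesh_element hM _.
Qed.

Lemma face_measurable k : measurable (face (m := M) k).
Proof. by have [] := closed_convex_face k. Qed.

Lemma face_measure_gt0 k : (0 < face_measure k (face (m := M) k))%E.
Proof.
have [_ mF hF] := closed_convex_face k.
apply: surface_gt0 => //; first exact: face_unit hM _.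
  exact: face_plane hM _.
exact: (face_dim hM k).1.
Qed.

Lemma face_measure_fin k : (face_measure k (face (m := M) k) < +oo)%E.
Proof.
apply: surface_fin => //; [exact: face_measurable|].
apply: norm_boundedS (@face_sub_cell k) _.
by apply: element_bounded; exact: mesh_element hM _.
Qed.

Context (rho : R) (hrho : 0 < rho) (hshape : shape_regular rho M).

Lemma cell_interior i : (cell (m := M) i)^° !=set0.
Proof.
have [x0 Hx0] := hshape i; exists x0; apply: Hx0 => /=.
rewrite subrr /enorm -(scale0r 0) dotZr mul0r sqrtr0 mulr_gt0//.
exact/diam_element_gt0/(mesh_element hM).
Qed.

Lemma volume_gt0 (i : 'I_(ncells M)) : 0 < volume i.
Proof.
apply: fine_gt0; apply/andP; split.
  by apply: lebesgue_rV_gt0; [exact: cell_measurable|exact: cell_interior].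
apply: lebesgue_rV_fin; first exact: cell_measurable.
exact/element_bounded/(mesh_element hM).
Qed.

(** An intersection of codimension one would be a face, and one of full dimension
    would contain a simplex, hence interior points of both cells. *)
Lemma cells_without_face (i j : 'I_(ncells M)) : i != j ->
  ~ (exists k, (inner k = i /\ outer k = Some j) \/
               (inner k = j /\ outer k = Some i)) ->
  ~ affine_dim_ge (cell i `&` cell j) d.-1.
Proof.
move=> ij noface ge1; apply: noface; apply: (interior_face_all hM ij).
split=> //; rewrite prednK// => -[x0 [B [x0ij Bij fB]]].
have [_ _ hi] := closed_convex_element (mesh_element hM i).
have [_ _ hj] := closed_convex_element (mesh_element hM j).
have [x] := simplex_interior erefl (hull_stableI hi hj) x0ij Bij fB.
rewrite interiorI => xij.
by have : set0 x by rewrite -(mesh_disjoint hM ij).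
Qed.

(** The jumps across interior faces propagate the value 0 from the Dirichlet
    boundary to all cells, the domain being connected. *)
Lemma jump_eq0 (y : P0 M) : bounded_domain Omega ->
  (exists k : 'I_(nfaces M), dirichlet k) ->
  (forall k : 'I_(nfaces M), ~~ neumann k -> jump y k = 0) -> y = 0.
Proof.
move=> [Oo Oc _ _] [k0 /andP[/eqP k0b k0D]] y0.
have yk0 : y (inner k0) == 0.
  by have := y0 _ k0D; rewrite /jump k0b subr0 => ->.
apply/ffunP => j; rewrite [RHS]ffunE; apply/eqP.
apply: (@domain_cells_connected _ _ Omega _ (@cell _ _ M) (fun i => y i == 0)
  hd Oo Oc _ _ _ cell_interior (mesh_inside hM) (mesh_disjoint hM) _ _ _ yk0).
- by rewrite -(mesh_cover hM); exact: subset_closure.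
- by move=> i; have [] := closed_convex_element (mesh_element hM i).
- by move=> i; have [] := closed_convex_element (mesh_element hM i).
move=> a b /eqP ya yb; apply: cells_without_face.
  by apply: contraNneq yb => <-; rewrite ya.
move=> [k kab]; case/negP: yb.
have kN : ~~ neumann k.
  apply/negP => /(neumann_face hM)[kb _].
  by case: kab => -[_]; rewrite kb.
have := y0 _ kN; rewrite /jump; case: kab => -[-> ->]; rewrite ya.
  by rewrite sub0r => /eqP; rewrite oppr_eq0.
by rewrite subr0 => ->.
Qed.

Lemma mesh_size_ge0 : 0 <= mesh_size M.
Proof. exact: bigmax_ge_id. Qed.

End mesh_geometry.

(** * Fluxes, jumps and the correction equation *)

Section integrals.
Context d (T : measurableType d) (R : realType) (mu : {measure set T -> \bar R}).
Context (D : set T) (mD : measurable D) (muD : (mu D < +oo)%E).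

Lemma integrable_cst (r : R) : mu.-integrable D (EFin \o (fun=> r)).
Proof.
apply/integrableP; split; first exact: measurable_cst.
by rewrite [X in (X < _)%E](integral_cst mu mD `|r|%:E) lte_mul_pinfty// lee_fin.
Qed.

Lemma integral_sqr_shift (f : T -> R) (a : R) :
  mu.-integrable D (EFin \o f) -> (\int[mu]_(x in D) ((f x) ^+ 2)%:E < +oo)%E ->
  (\int[mu]_(x in D) ((f x - a) ^+ 2)%:E)%E =
  (\int[mu]_(x in D) (f x) ^+ 2 - 2 * a * \int[mu]_(x in D) f x
   + a ^+ 2 * fine (mu D))%:E.
Proof.
move=> fi f2.
have mf : measurable_fun D f by apply/measurable_EFinP; exact: measurable_int fi.
have f2i : mu.-integrable D (EFin \o (fun x => (f x) ^+ 2)).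
  apply/integrableP; split.
    by apply/measurable_EFinP; exact: measurable_funX.
  under eq_integral do rewrite /= ger0_norm ?sqr_ge0//.
  exact: f2.
have ci : mu.-integrable D (EFin \o (fun=> a ^+ 2)).
  exact: integrable_cst.
have afi : mu.-integrable D (EFin \o (fun x => (2 * a) * f x)).
  by have := integrableZl mD (2 * a) fi.
have bi : mu.-integrable D (EFin \o (fun x => (f x) ^+ 2 - 2 * a * f x)).
  by have := integrableB mD f2i afi.
have E x : (f x - a) ^+ 2 = (f x) ^+ 2 - 2 * a * f x + a ^+ 2 by ring.
have si : mu.-integrable D (EFin \o (fun x => (f x - a) ^+ 2)).
  have := integrableD mD bi ci; apply: eq_integrable => // x _ /=.
  by rewrite E.
rewrite -[LHS]fineK; last exact: integrable_fin_num.
rewrite -[fine _]/(\int[mu]_(x in D) (f x - a) ^+ 2); congr EFin.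
under eq_Rintegral do rewrite E.
by rewrite RintegralD// RintegralB// RintegralZl// Rintegral_cst.
Qed.

End integrals.

Section discrete.
Context (R : realType) (d : nat) (hd : (0 < d)%N).
Context (Omega GammaD GammaN : set 'rV[R]_d) (M : mesh R d).
Context (hM : is_mesh Omega GammaD GammaN M).
Local Notation leb := (lebesgue_rV R d).
Implicit Types (v : face_fun M) (w y : P0 M) (k : 'I_(nfaces M)).
Implicit Types (i : 'I_(ncells M)) (q : 'rV[R]_d -> R).

Definition area k : R := fine (face_measure k (face k)).
Definition face_integral v k : R := \int[face_measure k]_(x in face k) v k x.

Lemma area_gt0 k : 0 < area k.
Proof.
by apply: fine_gt0; rewrite (face_measure_gt0 hd hM k) (face_measure_fin hM k).
Qed.

(** The sign of [n_F . n_E]: entry of the incidence matrix of cells and faces. *)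
Definition incidence i k : R :=
  if inner k == i then 1 else if outer k == Some i then -1 else 0.

Lemma boundary_fluxE v i : L1_faces v ->
  boundary_flux i v = \sum_k incidence i k * face_integral v k.
Proof.
move=> v1; rewrite /boundary_flux big_mkcond /=; apply: eq_bigr => k _.
have n1 := dot_unit (face_unit hM k).
have mF := face_measurable hM k.
rewrite /Defs.adjacent /cell_normal /incidence; case: eqP => [_|_] /=.
  by rewrite (RintegralZr _ mF (v1 k)) n1 mulrC.
case: eqP => _; last by rewrite mul0r.
by rewrite (RintegralZr _ mF (v1 k)) dotNr n1 mulrC.
Qed.

Lemma jumpE w k : jump w k = \sum_i incidence i k * w i.
Proof.
rewrite /jump /incidence (bigD1 (inner k))//= eqxx mul1r; congr (_ + _).
case E : (outer k) => [j|]; last first.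
  rewrite oppr0 big1// => i; rewrite eq_sym => /negbTE ->.
  by rewrite mul0r.
have [kj _] := interior_face hM E.
rewrite (bigD1 j)/=; last by rewrite eq_sym.
rewrite (negbTE kj) eqxx mulN1r big1 ?addr0// => i.
move=> /andP[ik ij]; rewrite eq_sym (negbTE ik).
rewrite (_ : Some j == Some i = false) ?mul0r//.
by apply: contraNF ij => /eqP[->].
Qed.

(** Summation by parts: an interior face is crossed by the fluxes out of its two
    cells, with opposite signs. *)
Lemma sum_boundary_flux v w : L1_faces v ->
  \sum_i w i * boundary_flux i v = \sum_k jump w k * face_integral v k.
Proof.
move=> v1; under eq_bigr do rewrite boundary_fluxE// mulr_sumr.
rewrite exchange_big; apply: eq_bigr => k _ /=.
by rewrite jumpE mulr_suml; apply: eq_bigr => i _; rewrite mulrCA mulrA.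
Qed.

Section correction.
Context (rho : R) (hrho : 0 < rho) (hshape : shape_regular rho M).
Context (omega : 'I_(nfaces M) -> R) (homega : forall k, 0 < omega k).

Definition jump_form y w : R :=
  \sum_(k | ~~ neumann k) (omega k)^-1 * jump y k * jump w k * area k.

Lemma cell_inner_residual q v w : cell_inner (residual q v) w =
  \sum_i w i * (\int[leb]_(x in cell i) q x - boundary_flux i v).
Proof.
apply: eq_bigr => i _; have V0 := volume_gt0 hM hrho hshape i.
rewrite Rintegral_cst; last exact: (cell_measurable hM).
rewrite -[fine _]/(volume i) !ffunE -mulrBr.
set X := (_ - _); rewrite [RHS]mulrC -[RHS]mul1r -(divff (lt0r_neq0 V0)).
ring.
Qed.

Lemma correction_eqP q v y : correction_eq omega q v y <->
  forall w, jump_form y w =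
    \sum_i w i * (\int[leb]_(x in cell i) q x - boundary_flux i v).
Proof.
suff E w : face_inner (fun k => ~~ neumann k) (fun k _ => (omega k)^-1 * jump y k)
    (fun k _ => jump w k) = jump_form y w.
  by split=> H w; have := H w; rewrite E cell_inner_residual.
by apply: eq_bigr => k _; rewrite Rintegral_cst//; exact: (face_measurable hM).
Qed.

Lemma jump_form_eq0 y : jump_form y y = 0 ->
  forall k, ~~ neumann k -> jump y k = 0.
Proof.
move=> /eqP; rewrite psumr_eq0; last first.
  move=> k _; rewrite -(mulrA _^-1) -expr2.
  by rewrite 2?mulr_ge0 ?sqr_ge0 ?invr_ge0// ltW// area_gt0.
move=> /allP y0 k kN; apply/eqP.
have := y0 k (mem_index_enum _); rewrite kN /=.
by rewrite !mulf_eq0 invr_eq0 (gt_eqF (homega k)) (gt_eqF (area_gt0 k)) orbF orbb.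
Qed.

Definition indicator i : P0 M := [ffun j => (j == i)%:R].

Lemma sum_indicator (F : 'I_(ncells M) -> R) i :
  \sum_j indicator i j * F j = F i.
Proof.
rewrite (bigD1 i)//= ffunE eqxx mul1r big1 ?addr0// => j /negbTE ji.
by rewrite ffunE ji mul0r.
Qed.

Lemma L1_corrected v y : L1_faces v -> L1_faces (corrected omega v y).
Proof.
move=> v1 k; have [kN|kN] := boolP (neumann k).
  apply: eq_integrable (v1 k) => [|x _]; first exact: (face_measurable hM).
  by rewrite /= /corrected kN.
have ci := integrable_cst (face_measurable hM k) (face_measure_fin hM k)
  ((omega k)^-1 * jump y k).
have := integrableD (face_measurable hM k) (v1 k) ci.
apply: eq_integrable => [|x _]; first exact: (face_measurable hM).
by rewrite /= /corrected (negbTE kN).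
Qed.

Lemma face_integral_corrected v y k : L1_faces v ->
  face_integral (corrected omega v y) k = face_integral v k +
    if neumann k then 0 else (omega k)^-1 * jump y k * area k.
Proof.
move=> v1; rewrite /face_integral /corrected; case: ifP => _; first by rewrite addr0.
have mF := face_measurable hM k.
have ci := integrable_cst mF (face_measure_fin hM k) ((omega k)^-1 * jump y k).
by rewrite (RintegralD mF (v1 k) ci) Rintegral_cst.
Qed.

(** Tested with the indicator of a cell, the correction equation says that the
    correction adds exactly the missing flux. *)
Lemma corrected_locally_conservative q v y : L1_faces v ->
  correction_eq omega q v y -> locally_conservative q (corrected omega v y).
Proof.
move=> v1 /correction_eqP Hy i.
rewrite -[LHS](sum_indicator (fun j => boundary_flux j _)).
rewrite sum_boundary_flux; last exact: L1_corrected.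
under eq_bigr do rewrite face_integral_corrected// mulrDr.
rewrite big_split /= -sum_boundary_flux// sum_indicator.
rewrite (_ : \sum_k _ = jump_form y (indicator i)); last first.
  rewrite /jump_form [RHS]big_mkcond; apply: eq_bigr => k _.
  case: neumann => /=; first by rewrite mulr0.
  ring.
by rewrite Hy sum_indicator addrC subrK.
Qed.

(** The matrix of the quadratic form [jump_form] is definite, hence invertible. *)
Lemma correction_eq_unique_ex q v : bounded_domain Omega ->
  (exists k : 'I_(nfaces M), dirichlet k) ->
  exists! y, correction_eq omega q v y.
Proof.
move=> hO hDir.
pose rhs i := \int[leb]_(x in cell i) q x - boundary_flux i v.
pose row_of w : 'rV[R]_(ncells M) := \row_i w i.
pose A := \matrix_(i, j) jump_form (indicator i) (indicator j).
have jump_ind i k : jump (indicator i) k = incidence i k.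
  by rewrite jumpE; under eq_bigr do rewrite mulrC; rewrite sum_indicator.
have AE y w : jump_form y w = \sum_i w i * (row_of y *m A) 0 i.
  under [RHS]eq_bigr => i _ do (rewrite mxE mulr_sumr;
    under eq_bigr => j _ do rewrite !mxE /jump_form !mulr_sumr).
  rewrite /jump_form exchange_big /=.
  under [RHS]eq_bigr => i _ do rewrite exchange_big /=.
  rewrite [RHS]exchange_big /=; apply: eq_bigr => k _.
  rewrite [RHS]exchange_big /= [jump w k]jumpE mulr_sumr mulr_suml.
  apply: eq_bigr => i _; rewrite [jump y k]jumpE mulr_sumr !mulr_suml.
  by apply: eq_bigr => j _; rewrite !jump_ind; ring.
have corrE y : correction_eq omega q v y <-> row_of y *m A = \row_i rhs i.
  rewrite correction_eqP; split=> [H|H w].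
    apply/rowP => i; have := H (indicator i).
    by rewrite AE !sum_indicator => ->; rewrite mxE.
  by rewrite AE H; apply: eq_bigr => i _; rewrite mxE.
have definite y : row_of y *m A = 0 -> y = 0.
  move=> yA; apply: (jump_eq0 hd hM hrho hshape hO hDir); apply: jump_form_eq0.
  by rewrite AE yA big1// => i _; rewrite mxE mulr0.
have Au : A \in unitmx.
  rewrite -row_free_unit -kermx_eq0; apply/rowV0P => x /sub_kermxP.
  have xE : x = row_of [ffun i => x 0 i] by apply/rowP => i; rewrite !mxE ffunE.
  rewrite xE => /definite /ffunP x0; apply/rowP => i.
  by have := x0 i; rewrite !mxE !ffunE.
exists [ffun i => (\row_i rhs i *m invmx A) 0 i]; split.
  apply/corrE; rewrite (_ : row_of _ = \row_i rhs i *m invmx A) ?mulmxKV//.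
  by apply/rowP => i; rewrite mxE ffunE.
move=> y /corrE yA; apply/ffunP => i.
by rewrite ffunE -yA mulmxK// mxE.
Qed.

(** With the correction [a_F = omega_F^-1 [y]_F] and the error [e] of the given
    flux, the two sides are the [omega]-weighted products of [a] with [a] and of
    [e] with [a]: testing the correction equation with [y] itself makes [a]
    orthogonal to [e - a]. Conservation by [U] turns the residual of [v] into the
    divergence of [e]. *)
Lemma correction_orthogonal q v y (U : face_fun M) : L1_faces v -> L1_faces U ->
  locally_conservative q U -> exact_on_neumann U v ->
  correction_eq omega q v y ->
  \sum_(k | ~~ neumann k) (omega k)^-1 * jump y k ^+ 2 * area k =
  \sum_(k | ~~ neumann k) jump y k * (face_integral U k - face_integral v k).
Proof.
move=> v1 U1 hUq hN /correction_eqP/(_ y).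
rewrite /jump_form; under eq_bigr do rewrite -(mulrA _^-1) -expr2.
move=> ->; under eq_bigr do rewrite -hUq mulrBr.
rewrite sumrB !sum_boundary_flux// -sumrB [RHS]big_mkcond.
apply: eq_bigr => k _; rewrite -mulrBr; case: ifP => // /negbFE kN.
suff -> : face_integral U k = face_integral v k by rewrite subrr mulr0.
congr fine; apply: ae_eq_integral.
- exact: (face_measurable hM).
- exact: measurable_int (U1 k).
- exact: measurable_int (v1 k).
- by apply: filterS (hN k kN) => x H /H ->.
Qed.

(** Pythagoras for [e = (e - a) + a], followed by the comparison of the weighted
    norm with the unweighted one. When the error is not square integrable the
    right-hand side is infinite. *)
Lemma corrected_error_le q v y (U : face_fun M) (omega0 omega1 : R) :
  0 < omega0 -> 0 < omega1 -> (forall k, omega0 <= omega k <= omega1) ->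
  L1_faces v -> L1_faces U ->
  locally_conservative q U -> exact_on_neumann U v ->
  correction_eq omega q v y ->
  (\sum_k \int[face_measure k]_(x in face k)
      ((U k x - corrected omega v y k x) ^+ 2)%:E <=
   (omega1 / omega0)%:E * \sum_k \int[face_measure k]_(x in face k)
      ((U k x - v k x) ^+ 2)%:E)%E.
Proof.
move=> w0 w1 hw v1 U1 hUq hN hy.
pose f k x := U k x - v k x.
set S := (\sum_k \int[face_measure k]_(x in face k) ((f k x) ^+ 2)%:E)%E.
have f2_ge0 k : (0 <= \int[face_measure k]_(x in face k) ((f k x) ^+ 2)%:E)%E.
  by apply: integral_ge0 => x _; rewrite lee_fin sqr_ge0.
have [Soo|Soo] := eqVneq S +oo%E.
  by rewrite Soo gt0_muley ?leey// lte_fin divr_gt0.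
have f2_fin k : (\int[face_measure k]_(x in face k) ((f k x) ^+ 2)%:E < +oo)%E.
  apply: (@le_lt_trans _ _ S); last by rewrite ltey.
  by rewrite /S (bigD1 k)//= leeDl// sume_ge0.
have mF := face_measurable hM.
have fi k : (face_measure k).-integrable (face k) (EFin \o f k).
  by have := integrableB (mF k) (U1 k) (v1 k).
pose F k := \int[face_measure k]_(x in face k) (f k x) ^+ 2.
pose m k := face_integral U k - face_integral v k.
pose a k := (omega k)^-1 * jump y k.
pose E k := if neumann k then F k else F k - 2 * a k * m k + a k ^+ 2 * area k.
have FE k : (\int[face_measure k]_(x in face k) ((f k x) ^+ 2)%:E)%E = (F k)%:E.
  have Ffin : (\int[face_measure k]_(x in face k) ((f k x) ^+ 2)%:E)%E \is a fin_num.
    by rewrite ge0_fin_numE.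
  exact/esym/fineK.
have EE k : (\int[face_measure k]_(x in face k)
    ((U k x - corrected omega v y k x) ^+ 2)%:E)%E = (E k)%:E.
  rewrite /E /corrected; case: ifP => kN; first exact: FE.
  under eq_integral do rewrite opprD addrA -/(f k _) -/(a k).
  rewrite (integral_sqr_shift (mF k) (face_measure_fin hM k) _ (fi k) (f2_fin k)).
  by rewrite /m /face_integral -(RintegralB (mF k) (U1 k) (v1 k)).
have E_ge0 k : 0 <= E k.
  by rewrite -lee_fin -EE; apply: integral_ge0 => x _; rewrite lee_fin sqr_ge0.
have F_ge0 k : 0 <= F k by rewrite -lee_fin -FE.
rewrite /S; under eq_bigr do rewrite EE.
under [in leRHS]eq_bigr do rewrite FE.
rewrite !sumEFin -EFinM lee_fin mulrAC ler_pdivlMr// mulrC.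
apply: (@le_trans _ _ (\sum_k omega k * E k)).
  rewrite mulr_sumr; apply: ler_sum => k _; rewrite ler_wpM2r//.
  by case/andP: (hw k).
apply: (@le_trans _ _ (\sum_k omega k * F k)); last first.
  rewrite mulr_sumr; apply: ler_sum => k _; rewrite ler_wpM2r//.
  by case/andP: (hw k).
(* By orthogonality, the sum of the bracket is that of omega_F a_F^2 |F|. *)
have EFk k : omega k * E k = omega k * F k - (if ~~ neumann k then
    2 * (jump y k * m k) - (omega k)^-1 * jump y k ^+ 2 * area k else 0).
  rewrite /E; case: neumann => /=; first by rewrite subr0.
  have wk : omega k != 0 by rewrite gt_eqF.
  by rewrite /a; field.
under eq_bigr do rewrite EFk.
rewrite sumrB lerBlDr lerDl -big_mkcond /= sumrB -mulr_sumr.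
rewrite -(correction_orthogonal v1 U1 hUq hN hy) mulr_natl mulr2n addrK.
apply: sumr_ge0 => k _.
by rewrite 2?mulr_ge0 ?sqr_ge0 ?invr_ge0// ltW// area_gt0.
Qed.

End correction.

(** Green's formula against the constant 1. *)
Lemma normal_trace_conservative (u : 'rV[R]_d -> 'rV[R]_d) q (U : face_fun M) :
  normal_trace Omega u U -> weak_divergence Omega u q -> locally_conservative q U.
Proof.
move=> [_ HU] hq i.
have p0 a : partial a (cst (1 : R)) = cst 0 :> ('rV[R]_d -> R).
  by apply/funext => x; rewrite /partial derive_cst.
have C1_cst : C1 (cst (1 : R) : 'rV[R]_d -> R).
  split=> [x|a]; first exact: differentiable_cst.
  by rewrite p0; exact: cst_continuous.
have := HU q hq i _ C1_cst.
rewrite (_ : (fun k x => _) = U); last first.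
  by apply/funext => k; apply/funext => x; rewrite mulr1.
move=> ->; apply: eq_Rintegral => x _.
by rewrite mulr1 big1 ?add0r// => a _; rewrite p0 mulr0.
Qed.

End discrete.

(** * The convergence order *)

Lemma corrected_face_norm_le (R : realType) (d : nat) (hd : (0 < d)%N)
  (Omega GammaD GammaN : set 'rV[R]_d) (M : mesh R d)
  (hM : is_mesh Omega GammaD GammaN M) (rho : R) (hrho : 0 < rho)
  (hshape : shape_regular rho M) (omega : 'I_(nfaces M) -> R)
  (omega0 omega1 : R) (q : 'rV[R]_d -> R) (U v : face_fun M) (y : P0 M) :
  0 < omega0 -> 0 < omega1 -> (forall k, omega0 <= omega k <= omega1) ->
  L1_faces v -> L1_faces U ->
  locally_conservative q U -> exact_on_neumann U v ->
  correction_eq omega q v y ->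
  (face_norm (fun k x => (U k x - corrected omega v y k x)%R) <=
   (Num.sqrt (omega1 / omega0))%:E * face_norm (fun k x => (U k x - v k x)%R))%E.
Proof.
move=> w0 w1 hw v1 U1 hUq hN hy.
have wk k : 0 < omega k by case/andP: (hw k) => + _; exact: lt_le_trans.
have int_ge0 k (f : 'rV[R]_d -> R) :
    (0 <= \int[face_measure k]_(x in face k) ((f x) ^+ 2)%:E)%E.
  by apply: integral_ge0 => x _; rewrite lee_fin sqr_ge0.
have h0 : (0 <= (mesh_size M)%:E)%E by rewrite lee_fin; exact: mesh_size_ge0.
have k0 : (0 <= (omega1 / omega0)%:E)%E by rewrite lee_fin divr_ge0// ltW.
rewrite /face_norm -[(Num.sqrt _)%:E]/(sqrte (_)%:E) -sqrteM//.
rewrite -ge0_sume_distrr => [|k _]; last exact: int_ge0.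
rewrite -ge0_sume_distrr => [|k _]; last exact: int_ge0.
rewrite lee_sqrt; last first.
  apply: mule_ge0 => //; apply: mule_ge0 => //; apply: sume_ge0 => k _.
  exact: int_ge0.
rewrite muleCA; apply: lee_wpmul2l => //.
exact: (corrected_error_le hd hM hrho hshape wk w0 w1 hw v1 U1 hUq hN hy).
Qed.

Theorem theorem1 (R : realType) (d : nat) (hd : d = 2%N \/ d = 3%N)
  (Omega GammaD GammaN : set 'rV[R]_d)
  (hOmega : bounded_domain Omega)
  (hGamma : boundary_parts Omega GammaD GammaN)
  (K : 'rV[R]_d -> 'M[R]_d) (hK : permeability Omega K)
  (p : 'rV[R]_d -> R) (gradp u : 'rV[R]_d -> 'rV[R]_d) (q pB uB : 'rV[R]_d -> R)
  (hgradp : weak_gradient Omega p gradp)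
  (hu : u = darcy_velocity K gradp)
  (hflow : weak_divergence Omega u q)
  (I : Type) (M : I -> mesh R d)
  (hM : forall i, is_mesh Omega GammaD GammaN (M i))
  (rho : R) (hrho : 0 < rho) (hshape : forall i, shape_regular rho (M i))
  (tau : R) (htau : 0 < tau) (hunif : forall i, quasi_uniform tau (M i))
  (hD : forall i, exists k, dirichlet (M := M i) k)
  (U : forall i, face_fun (M i))
  (hU : forall i, normal_trace Omega u (U i))
  (hpB : forall i, dirichlet_condition (M i) Omega GammaD p pB)
  (huB : forall i, neumann_condition GammaN (U i) uB)
  (omega : forall i, 'I_(nfaces (M i)) -> R)
  (omega0 omega1 : R) (homega0 : 0 < omega0)
  (homega : forall i k, omega0 <= omega i k <= omega1)
  (Uh : forall i, face_fun (M i))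
  (hUh : forall i, L1_faces (Uh i)) :
  [/\ (* (i) *)
      forall i V, postprocessed (omega i) q (Uh i) V ->
        locally_conservative q V,
      (* (ii) *)
      forall i, (exists! y, correction_eq (omega i) q (Uh i) y) /\
                (exists! V, postprocessed (omega i) q (Uh i) V)
    & (* (iii) *)
      forall V : (forall i, face_fun (M i)),
        (forall i, postprocessed (omega i) q (Uh i) (V i)) ->
        (forall i, exact_on_neumann (U i) (Uh i)) ->
        forall s : R,
          (exists2 C : R, 0 < C & forall i,
             (face_norm (fun k x => (U i k x - Uh i k x)%R) <=
              (C * mesh_size (M i) `^ s)%:E)%E) ->
          (exists2 C : R, 0 < C & forall i,
             (face_norm (fun k x => (U i k x - V i k x)%R) <=
              (C * mesh_size (M i) `^ s)%:E)%E)].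
Proof.
have d0 : (0 < d)%N by case: hd => ->.
have w0 i k : 0 < omega i k.
  by case/andP: (homega i k) => + _; exact: lt_le_trans.
split.
- move=> i V [y hy ->].
  exact: (corrected_locally_conservative (hM i) hrho (hshape i) (hUh i) hy).
- move=> i; have [y [hy yU]] := correction_eq_unique_ex d0 (hM i) hrho
    (hshape i) (w0 i) q (Uh i) hOmega (hD i).
  split; first by exists y.
  exists (corrected (omega i) (Uh i) y); split; first by exists y.
  by move=> V [z /yU <- ->].
- move=> V hV hN s [C C0 HC].
  (* Over an empty family of meshes, omega1 may be negative. *)
  pose omega2 := Num.max omega0 omega1.
  have w2 : 0 < omega2 by rewrite lt_max homega0.
  have w02 i k : omega0 <= omega i k <= omega2.
    by case/andP: (homega i k) => -> ?; rewrite le_max; apply/orP; right.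
  exists (Num.sqrt (omega2 / omega0) * C).
    by rewrite mulr_gt0// sqrtr_gt0 divr_gt0.
  move=> i; have [y hy ->] := hV i.
  have hUq := normal_trace_conservative (hU i) hflow.
  apply: le_trans (corrected_face_norm_le d0 (hM i) hrho (hshape i) homega0 w2
    (w02 i) (hUh i) (hU i).1 hUq (hN i) hy) _.
  rewrite -mulrA EFinM; apply: lee_wpmul2l; last exact: HC.
  by rewrite lee_fin sqrtr_ge0.
Qed.
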